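(* Let $G$ be a connected finite dimensional Lie group with Lie algebra $\mathfrak g$. Suppose that $(\pi,\mathcal H)$ is an irreducible unitary representation of $G$ with discrete kernel and that $\mathbf d\in\mathfrak g$ is such that $\partial\pi(\mathbf d)$ has an eigenvector in $\mathcal H$. Then $\mathrm{ad}(\mathbf d)$ is elliptic.
   Context: Unitary representations are strongly continuous. $\partial\pi(x)$ denotes the skew-adjoint infinitesimal generator of the unitary one-parameter group $t\mapsto\pi(\exp tx)$. An endomorphism of a finite dimensional real vector space is elliptic if it is semisimple (diagonalizable over $\mathbb C$) with purely imaginary spectrum. *)

(* Defs.v *)
From HB Require Import structures.
From mathcomp Require Import all_boot all_order all_algebra.
From mathcomp Require Import all_classical all_reals all_analysis.
From mathcomp Require Import complex sesquilinear.

Set Implicit Arguments.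
Unset Strict Implicit.
Unset Printing Implicit Defensive.

Import Order.TTheory GRing.Theory Num.Theory.
Import numFieldNormedType.Exports.

Local Open Scope classical_set_scope.
Local Open Scope ring_scope.

Section smooth.
Context {R : realType} {V W : normedModType R}.

(* In finite dimension the maps x |-> 'D_v f x, v : V, determine the            *)
(* differential, so this is the usual C^k (the set U is meant to be open).      *)
Fixpoint continuously_differentiable (k : nat) (U : set V) (f : V -> W) : Prop :=
  if k is k'.+1 then
    (forall x, U x -> differentiable f x) /\
    (forall v, continuously_differentiable k' U (fun x => 'D_v f x))
  else forall x, U x -> {for x, continuous f}.

Definition smooth_on (U : set V) (f : V -> W) : Prop :=
  forall k, continuously_differentiable k U f.

End smooth.

(* The values of chart_map outside chart_dom, and of chart_inv outside          *)
(* chart_cod, are irrelevant.                                                   *)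
Record chart (R : realType) (n : nat) (M : topologicalType) := Chart {
  chart_dom : set M;
  chart_cod : set 'rV[R]_n;
  chart_map : M -> 'rV[R]_n;
  chart_inv : 'rV[R]_n -> M;
  chart_dom_open : open chart_dom;
  chart_cod_open : open chart_cod;
  chart_mapP : forall p, chart_dom p -> chart_cod (chart_map p);
  chart_invP : forall x, chart_cod x -> chart_dom (chart_inv x);
  chart_mapK : forall p, chart_dom p -> chart_inv (chart_map p) = p;
  chart_invK : forall x, chart_cod x -> chart_map (chart_inv x) = x;
  chart_map_continuous :
    forall p, chart_dom p -> {for p, continuous chart_map};
  chart_inv_continuous :
    forall x, chart_cod x -> {for x, continuous chart_inv}
}.

(* The atlas need not be maximal. The preferred chart chart_at p identifies the *)
(* tangent space at p with 'rV[R]_n.                                            *)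
HB.mixin Record isManifold (R : realType) (n : nat) M of Topological M := {
  manifold_hausdorff : hausdorff_space M;
  atlas : set (chart R n M);
  chart_at : M -> chart R n M;
  chart_at_atlas : forall p, atlas (chart_at p);
  chart_at_dom : forall p, chart_dom (chart_at p) p;
  atlas_smooth : forall c c', atlas c -> atlas c' ->
    smooth_on [set x | chart_cod c x /\ chart_dom c' (chart_inv c x)]
              (chart_map c' \o chart_inv c)
}.

#[short(type="manifoldType")]
HB.structure Definition Manifold (R : realType) (n : nat) :=
  {M of isManifold R n M & Topological M}.

HB.mixin Record isLieGroup (R : realType) (n : nat) G
    of Manifold R n G & Group G := {
  lie_mul_continuous : continuous (fun p : G * G => (p.1 * p.2)%g);
  lie_inv_continuous : continuous (fun g : G => g^-1%g);
  lie_mul_smooth : forall c1 c2 c3 : chart R n G,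
    atlas c1 -> atlas c2 -> atlas c3 ->
    smooth_on
      [set xy : 'rV[R]_n * 'rV[R]_n | [/\ chart_cod c1 xy.1, chart_cod c2 xy.2 &
         chart_dom c3 (chart_inv c1 xy.1 * chart_inv c2 xy.2)%g]]
      (fun xy => chart_map c3 (chart_inv c1 xy.1 * chart_inv c2 xy.2)%g);
  lie_inv_smooth : forall c1 c2 : chart R n G, atlas c1 -> atlas c2 ->
    smooth_on [set x | chart_cod c1 x /\ chart_dom c2 (chart_inv c1 x)^-1%g]
              (fun x => chart_map c2 (chart_inv c1 x)^-1%g)
}.

#[short(type="lieGroupType")]
HB.structure Definition LieGroup (R : realType) (n : nat) :=
  {G of isLieGroup R n G & Manifold R n G & Group G}.

Lemma bracket_linear (R : realType) (U V W : normedModType R)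
    (i1 i2 : U -> V) (f : V -> W) (p0 : V) v :
  linear i1 -> linear i2 ->
  (\near p0, differentiable f p0) ->
  (forall w, differentiable ('D_(i2 w) f) p0) ->
  linear (fun w => 'D_(i1 v) ('D_(i2 w) f) p0 - 'D_(i1 w) ('D_(i2 v) f) p0).
Proof.
move=> l1 l2 df dg a w w'.
have e1 : 'D_(i1 v) ('D_(i2 (a *: w + w')) f) p0 =
    a *: 'D_(i1 v) ('D_(i2 w) f) p0 + 'D_(i1 v) ('D_(i2 w') f) p0.
  have <- : 'D_(i1 v) (a *: 'D_(i2 w) f + 'D_(i2 w') f) p0 =
      a *: 'D_(i1 v) ('D_(i2 w) f) p0 + 'D_(i1 v) ('D_(i2 w') f) p0.
    have dw : derivable ('D_(i2 w) f) p0 (i1 v) by exact: diff_derivable.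
    rewrite deriveD; [by rewrite deriveZ| exact: derivableZ|].
    exact: diff_derivable.
  apply: near_eq_derive; near=> p.
  have dp : differentiable f p by near: p.
  rewrite -[RHS]/(a *: 'D_(i2 w) f p + 'D_(i2 w') f p) !(deriveE _ dp).
  by rewrite l2 linearP.
rewrite e1 !(deriveE _ (dg v)) l1.
by rewrite linearP scalerBr opprD addrACA.
Unshelve. all: by end_near. Qed.

Section lie_algebra.
Context {R : realType} {n : nat} (G : lieGroupType R n).

Definition chart1 : chart R n G := chart_at (1%g : G).

Definition origin : 'rV[R]_n := chart_map chart1 1%g.

Definition local_mul (x y : 'rV[R]_n) : 'rV[R]_n :=
  chart_map chart1 (chart_inv chart1 x * chart_inv chart1 y)%g.

(* The left invariant vector field with value v at 1, in the chart chart1.      *)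
Definition left_field (v x : 'rV[R]_n) : 'rV[R]_n := 'D_v (local_mul x) origin.

(* The Lie algebra is the tangent space at 1, that is 'rV[R]_n through chart1,  *)
(* and its bracket is the value at 1 of the bracket of vector fields            *)
(* [X, Y] = DY X - DX Y of the left invariant extensions.                       *)
Definition lie_bracket (v w : 'rV[R]_n) : 'rV[R]_n :=
  'D_v (left_field w) origin - 'D_w (left_field v) origin.

Local Notation E := 'rV[R]_n.
Local Notation c := chart1.
Local Notation o := origin.
Let m (p : E * E) : E := local_mul p.1 p.2.
Let S : set (E * E) := [set xy : E * E | [/\ chart_cod c xy.1, chart_cod c xy.2 &
         chart_dom c (chart_inv c xy.1 * chart_inv c xy.2)%g]].

Lemma local_mul_smooth : smooth_on S m.
Proof. by apply: lie_mul_smooth; exact: chart_at_atlas. Qed.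

Lemma local_mul_dom_nbhs : nbhs ((o, o) : E * E) S.
Proof.
have c1 : chart_dom c 1%g by exact: chart_at_dom.
have co : chart_cod c o by exact: chart_mapP.
have oK : chart_inv c o = 1%g by exact: chart_mapK.
have Vo : nbhs o (chart_cod c).
  by apply: open_nbhs_nbhs; split => //; exact: chart_cod_open.
have W : nbhs ((o, o) : E * E) [set xy : E * E | chart_dom c (chart_inv c xy.1 * chart_inv c xy.2)%g].
  have cv : (chart_inv c xy.1 * chart_inv c xy.2)%g @[xy --> ((o, o) : E * E)] --> (1 : G)%g.
    have -> : (1 : G)%g = (chart_inv c (o,o).1 * chart_inv c (o,o).2)%g by rewrite /= oK mulg1.
    apply: (@cvg_comp _ _ _ (fun xy : E * E => (chart_inv c xy.1, chart_inv c xy.2))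
      (fun p : G * G => (p.1 * p.2)%g)); last exact: (lie_mul_continuous (chart_inv c o, chart_inv c o)).
    apply: cvg_pair => /=.
    - apply: (@cvg_comp _ _ _ fst (chart_inv c)); [exact: cvg_fst | exact: chart_inv_continuous].
    - apply: (@cvg_comp _ _ _ snd (chart_inv c)); [exact: cvg_snd | exact: chart_inv_continuous].
  apply: (cv (chart_dom c)); apply: open_nbhs_nbhs; split => //; exact: chart_dom_open.
have V1 : nbhs ((o, o) : E * E) [set xy : E * E | chart_cod c xy.1] by exact: cvg_fst.
have V2 : nbhs ((o, o) : E * E) [set xy : E * E | chart_cod c xy.2] by exact: cvg_snd.
near=> xy; split; near: xy; [exact: V1|exact: V2|exact: W].
Unshelve. all: by end_near. Qed.

Lemma derive_pair1 (g : E * E -> E) v x y :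
  'D_v (fun z => g (z, y)) x = 'D_(v, (0 : E)) g (x, y).
Proof.
rewrite /derive /=.
set f := fun h : R => _; set k := fun h : R => _.
suff -> : f = k by []; apply/funext => h; rewrite /f /k.
by have -> : h *: (v, (0 : E)) + (x, y) = (h *: v + x, y) :> E * E
  by congr pair => /=; rewrite scaler0 add0r.
Qed.

Lemma derive_pair2 (g : E * E -> E) v x y :
  'D_v (fun z => g (x, z)) y = 'D_((0 : E), v) g (x, y).
Proof.
rewrite /derive /=.
set f := fun h : R => _; set k := fun h : R => _.
suff -> : f = k by []; apply/funext => h; rewrite /f /k.
by have -> : h *: ((0 : E), v) + (x, y) = (x, h *: v + y) :> E * E
  by congr pair => /=; rewrite scaler0 add0r.
Qed.

Lemma left_fieldE v : left_field v = fun x => 'D_((0 : E), v) m (x, o).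
Proof. by apply/funext => x; rewrite -derive_pair2. Qed.

Lemma derive_fieldE v w : 'D_v (left_field w) o = 'D_(v, (0 : E)) ('D_((0 : E), w) m) (o, o).
Proof. by rewrite left_fieldE; exact: derive_pair1. Qed.

Lemma lie_bracketE v w : lie_bracket v w =
  'D_(v, (0 : E)) ('D_((0 : E), w) m) (o, o) - 'D_(w, (0 : E)) ('D_((0 : E), v) m) (o, o).
Proof. by rewrite /lie_bracket (derive_fieldE v w) (derive_fieldE w v). Qed.

Lemma lie_bracket_is_linear v : linear (lie_bracket v).
Proof.
have li1 : linear (fun v : E => (v, (0 : E)) : E * E).
  by move=> a w w'; congr pair => /=; rewrite scaler0 addr0.
have li2 : linear (fun v : E => ((0 : E), v) : E * E).
  by move=> a w w'; congr pair => /=; rewrite scaler0 addr0.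
have [m1 m2] := local_mul_smooth 2.
have := @bracket_linear _ _ _ _ _ _ m (o, o) v li1 li2.
rewrite (_ : (fun w => _) = lie_bracket v); last first.
  by apply/funext => w; rewrite lie_bracketE.
apply; first by near=> p; apply: m1; near: p; exact: local_mul_dom_nbhs.
move=> w; have [+ _] := m2 (0, w); apply; exact: (nbhs_singleton local_mul_dom_nbhs).
Unshelve. all: by end_near. Qed.

Definition ad (v : 'rV[R]_n) : 'rV[R]_n -> 'rV[R]_n := lie_bracket v.

HB.instance Definition _ (v : 'rV[R]_n) :=
  GRing.isLinear.Build R 'rV[R]_n 'rV[R]_n _ (ad v) (lie_bracket_is_linear v).

(* gamma t = exp (t x) for all t. A continuous homomorphism is smooth as soon   *)
(* as it is differentiable at 0.                                                *)
Definition one_parameter_subgroup (x : 'rV[R]_n) (gamma : R -> G) : Prop :=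
  [/\ continuous gamma,
      forall s t, gamma (s + t) = (gamma s * gamma t)%g
    & is_derive (0 : R^o) (1 : R^o) (chart_map chart1 \o gamma : R^o -> _) x].

End lie_algebra.

Definition elliptic {R : realType} {n : nat}
    (f : {linear 'rV[R]_n -> 'rV[R]_n}) : Prop :=
  let A : 'M[R[i]]_n := map_mx (real_complex R) (lin1_mx f) in
  diagonalizable A /\ forall a : R[i], eigenvalue A a -> complex.Re a = 0.

Section unitary_representations.
Context {R : realType} {n : nat} {G : lieGroupType R n}.
Context {H : completeNormedModType R[i]}.

(* The space H is then a complex Hilbert space.                                 *)
Definition hilbert_inner_product (ip : {dot H for Num.conj}) : Prop :=
  forall u : H, `|u| ^+ 2 = ip u u.

Record unitary_representation (ip : {dot H for Num.conj})
    (pi : G -> {linear H -> H}) : Prop := {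
  rep1 : forall u, pi 1%g u = u;
  repM : forall g h u, pi (g * h)%g u = pi g (pi h u);
  rep_isometry : forall g u v, ip (pi g u) (pi g v) = ip u v;
  rep_strongly_continuous : forall u, continuous (fun g => pi g u)
}.

Definition closed_subspace (V : set H) : Prop :=
  [/\ closed V, V 0, forall u v, V u -> V v -> V (u + v)
    & forall (a : R[i]) u, V u -> V (a *: u)].

Definition irreducible_representation (pi : G -> {linear H -> H}) : Prop :=
  (exists u : H, u != 0) /\
  forall V : set H, closed_subspace V ->
    (forall g u, V u -> V (pi g u)) -> V = [set 0] \/ V = setT.

Definition representation_kernel (pi : G -> {linear H -> H}) : set G :=
  [set g | forall u, pi g u = u].

(* The graph of the (in general unbounded) infinitesimal generator of the       *)
(* one-parameter group U.                                                       *)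
Definition infinitesimal_generator (U : R -> H -> H) (u v : H) : Prop :=
  (t%:C^-1)%C *: (U t u - u) @[t --> (0 : R)^'] --> v.

(* The graph of the skew-adjoint operator attached to x: (u, v) belongs to it   *)
(* iff u is in the domain and is mapped to v.                                   *)
Definition derived_operator (pi : G -> {linear H -> H}) (x : 'rV[R]_n)
    (u v : H) : Prop :=
  exists2 gamma : R -> G, one_parameter_subgroup x gamma &
    infinitesimal_generator (fun t => pi (gamma t)) u v.

Definition has_eigenvector (A : H -> H -> Prop) : Prop :=
  exists (u : H) (a : R[i]), u != 0 /\ A u (a *: u).

End unitary_representations.

Definition discrete_subset {T : topologicalType} (A : set T) : Prop :=
  A `<=` isolated A.

(* Main.v *)
Require Import Defs.
From mathcomp Require Import all_boot all_order all_algebra.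
From mathcomp Require Import all_classical all_reals all_analysis.
From mathcomp Require Import complex sesquilinear.
From mathcomp Require Import ring lra.
Set Implicit Arguments.
Unset Strict Implicit.
Unset Printing Implicit Defensive.
Import Order.TTheory GRing.Theory Num.Theory.
Import numFieldNormedType.Exports.
Local Open Scope classical_set_scope.
Local Open Scope ring_scope.

(** Why the theorem holds.  Let w be an eigenvector of the generator attached
to d and gamma the one-parameter subgroup of d, so that every gamma t preserves
the line through w.  The proof is a form of Moore's treatment of the Mautner
phenomenon; it shows that the conjugations by gamma t are uniformly Lipschitz
near the identity, so that their differentials, which form the one-parameter
group generated by ad d, are bounded.

Let K be the stabilizer of the line through w.  The modulus of the matrix
coefficient of w is a bi-K-invariant continuous function on G, and it is
maximal exactly on K.  Fix a compact neighbourhood C of the identity.  On the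
part of C outside V K, for a smaller open V, this function stays away from
its maximum, whereas it is close to its maximum on k U for every k in K, where U
is a small connected neighbourhood of the identity.  So k U, which meets V K in k,
cannot leave V K: thus K U is contained in C K (stable_nbhd).  As G is
connected, U generates G, and for every g the set K g is contained in some
compact set times K (orbits_relatively_compact).
Consequently every translate of w has, up to phases, a relatively compact
K-orbit, and if f is close to the identity then all the conjugates of f by K
move a given translate of w by little (conj_equicontinuous_vector).

An element that fixes every translate of w is in the kernel, by
irreducibility, and the kernel meets a small ball around the identity only in
the identity.  So a small sphere around the identity consists of elements that
move some translate of w, and conjugates of f by gamma t avoid this sphere
when f is close to the identity.  By connectedness in t they remain in the ball
(conj_equicontinuous).  In a chart the N-th power of a small element is nearly
N times that element; comparing powers of f with powers of its conjugates
turns equicontinuity into a Lipschitz estimate (equicontinuous_lipschitz).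

The differential Ad s of conjugation by gamma s is thus power bounded,
uniformly in s, and Ad s = 1 + s ad d + o(s); the symmetry of second derivatives
of the multiplication brings in the bracket here.  The Hille-Yosida estimate
for the resolvent of ad d (resolvent_bound) then forces its eigenvalues to be
purely imaginary and excludes Jordan blocks. *)

(** * Bounded one-parameter groups of linear maps *)

Lemma coord_norm_le {R : realType} {n : nat} (v : 'rV[R]_n) j : `|v ord0 j| <= `|v|.
Proof. by rewrite [leRHS]mx_normrE; apply: (le_bigmax _ _ (ord0, j)). Qed.

(** The minimal polynomial splits, and a repeated root z would make the product
with one factor 'X - z removed vanish already. *)
Lemma diagonalizable_semisimple (K : closedFieldType) m (A : 'M[K]_m) :
  (forall z (w : 'rV_m), (w *m A - z *: w) *m A = z *: (w *m A - z *: w) ->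
    w *m A = z *: w) -> diagonalizable A.
Proof.
case: m A => [A _|m A ss].
  by exists 1%:M; [exact: unitmx1|apply/is_diag_mxP => -[]].
apply/diagonalizableP.
have [rs prs] := closed_field_poly_normal (mxminpoly A).
have := mxminpoly_monic A; rewrite monicE => /eqP lead1.
rewrite lead1 scale1r in prs.
exists rs; last by rewrite -prs.
apply: contraT => nu.
have [z [q pq]] : exists z, exists q, mxminpoly A = q * ('X - z%:P) * ('X - z%:P).
  move: nu; rewrite prs; elim: (rs) => //= a s IH.
  rewrite negb_and negbK => /orP[ars|/IH[z [q e]]].
    by exists a, (\prod_(x <- rem a s) ('X - x%:P)); rewrite !big_cons (big_rem a)//=; ring.
  by exists z, (('X - a%:P) * q); rewrite !big_cons e; ring.
have X1 (w : 'rV_m.+1) : w *m horner_mx A ('X - z%:P) = w *m A - z *: w.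
  by rewrite rmorphB/= horner_mx_X horner_mx_C mulmxBr mul_mx_scalar.
have q0 : horner_mx A (q * ('X - z%:P)) = 0.
  apply/row_matrixP => i; rewrite row0 rowE rmorphM/= -mulmxE mulmxA X1.
  apply/eqP; rewrite subr_eq0; apply/eqP/ss.
  set w := _ *m horner_mx A q.
  apply/eqP; rewrite -subr_eq0 -X1 -X1 /w -!mulmxA !mulmxE -!rmorphM/= mulrA -pq.
  by rewrite mx_root_minpoly mulmx0.
have := mxminpoly_min q0; rewrite pq.
have q_neq0 : q * ('X - z%:P) != 0.
  apply/eqP => q0'; have := lead1; rewrite pq q0' mul0r lead_coef0 => /eqP.
  by rewrite eq_sym oner_eq0.
by rewrite -[X in _ %| X]mulr1 dvdp_mul2l// dvdp1 size_XsubC.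
Qed.

Section elliptic_criterion.
Context {R : realType} {n : nat}.
Local Notation E := 'rV[R]_n.
Local Notation EC := 'rV[R[i]]_n.
Local Notation rc := (real_complex R).
Local Notation normc := Normc.normc.

Let normcD (x y : R[i]) : normc (x + y) <= normc x + normc y.
Proof. exact: le_normcD. Qed.

Let normc_ge0 (x : R[i]) : 0 <= normc x.
Proof. by case: x => a b; exact: sqrtr_ge0. Qed.

Let normc_real (x : R) : normc (rc x) = `|x|.
Proof. by rewrite /= expr0n addr0 sqrtr_sqr. Qed.

Let normc_ge_Re (x : R[i]) : `|complex.Re x| <= normc x.
Proof.
case: x => a b /=; rewrite -(sqrtr_sqr a); apply: ler_wsqrtr.
by rewrite lerDl sqr_ge0.
Qed.

Let normc_ge_Im (x : R[i]) : `|complex.Im x| <= normc x.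
Proof.
case: x => a b /=; rewrite -(sqrtr_sqr b); apply: ler_wsqrtr.
by rewrite lerDr sqr_ge0.
Qed.

(** A norm on complex vectors with values in R, where real arithmetic is
available; the sup norm on EC takes its values in R[i]. *)
Definition norm1 (u : EC) : R := \sum_j normc (u ord0 j).

Lemma norm1_ge0 u : 0 <= norm1 u.
Proof. by apply: sumr_ge0 => j _; exact: normc_ge0. Qed.

Lemma norm1D u v : norm1 (u + v) <= norm1 u + norm1 v.
Proof. by rewrite -big_split; apply: ler_sum => j _; rewrite mxE normcD. Qed.

Lemma norm1Z a u : norm1 (a *: u) = normc a * norm1 u.
Proof.
by rewrite mulr_sumr; apply: eq_bigr => j _; rewrite mxE Normc.normcM.
Qed.

Lemma norm1_0 : norm1 0 = 0.
Proof. by rewrite /norm1 big1// => j _; rewrite mxE Normc.normc0. Qed.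

Lemma norm1_eq0 u : norm1 u = 0 -> u = 0.
Proof.
move=> /eqP; rewrite psumr_eq0 => [/allP u0|j _]; last exact: normc_ge0.
apply/rowP => j; rewrite mxE; apply: Normc.eq0_normc.
exact/eqP/(implyP (u0 j (mem_index_enum j))).
Qed.

Lemma norm1_real (v : E) : norm1 (map_mx rc v) <= n%:R * `|v|.
Proof.
rewrite mulr_natl -[X in _ *+ X](card_ord n) -sumr_const.
by apply: ler_sum => j _; rewrite mxE normc_real coord_norm_le.
Qed.

Let rowRe (u : EC) : E := map_mx (@complex.Re R) u.
Let rowIm (u : EC) : E := map_mx (@complex.Im R) u.

Let rowRe_le u : `|rowRe u| <= norm1 u.
Proof.
rewrite [leLHS]mx_normrE; apply: bigmax_le => [|[i j] _]; first exact: norm1_ge0.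
rewrite /= mxE (ord1 i) (le_trans (normc_ge_Re _))// /norm1.
by rewrite (bigD1 j)//= lerDl; apply: sumr_ge0 => k _; exact: normc_ge0.
Qed.

Let rowIm_le u : `|rowIm u| <= norm1 u.
Proof.
rewrite [leLHS]mx_normrE; apply: bigmax_le => [|[i j] _]; first exact: norm1_ge0.
rewrite /= mxE (ord1 i) (le_trans (normc_ge_Im _))// /norm1.
by rewrite (bigD1 j)//= lerDl; apply: sumr_ge0 => k _; exact: normc_ge0.
Qed.

Let decomp (u : EC) :
  u = map_mx rc (rowRe u) + (0 +i* 1)%C *: map_mx rc (rowIm u).
Proof.
apply/rowP => j; rewrite !mxE; case: (u ord0 j) => a b; apply/eqP.
by rewrite eq_complex /=; apply/andP; split; apply/eqP; ring.
Qed.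

Let cplx (f : {linear E -> E}) : 'M[R[i]]_n := map_mx rc (lin1_mx f).

Let cplx_real (f : {linear E -> E}) (v : E) :
  map_mx rc v *m cplx f = map_mx rc (f v).
Proof. by rewrite -map_mxM mul_rV_lin1. Qed.

Let cplxE (f : {linear E -> E}) (u : EC) : u *m cplx f =
  map_mx rc (f (rowRe u)) + (0 +i* 1)%C *: map_mx rc (f (rowIm u)).
Proof. by rewrite {1}(decomp u) mulmxDl -scalemxAl !cplx_real. Qed.

Let iter_cplx (f : {linear E -> E}) k (u : EC) : iter k (mulmx^~ (cplx f)) u =
  map_mx rc (iter k f (rowRe u)) + (0 +i* 1)%C *: map_mx rc (iter k f (rowIm u)).
Proof.
elim: k => [|k IH]/=; first exact: decomp.
by rewrite IH mulmxDl -scalemxAl !cplx_real.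
Qed.

Let norm1_decomp (a b : E) :
  norm1 (map_mx rc a + (0 +i* 1)%C *: map_mx rc b) <= n%:R * (`|a| + `|b|).
Proof.
apply: (le_trans (norm1D _ _)); rewrite norm1Z mulrDr lerD ?norm1_real//.
by rewrite /= expr0n expr1n add0r sqrtr1 mul1r norm1_real.
Qed.

Variables (f : {linear E -> E}) (F : R -> {linear E -> E}) (C : R).
Hypothesis F_derivative : forall v, s^-1 *: (F s v - v) @[s --> 0^'] --> f v.
Hypothesis F_power_bounded :
  \forall s \near 0^', forall k v, `|iter k (F s) v| <= C * `|v|.

Let C2 := n%:R * (`|C| + `|C|).

Let C2_ge0 : 0 <= C2.
Proof. by rewrite mulr_ge0// addr_ge0. Qed.

Let pow_bound s k u : (forall k v, `|iter k (F s) v| <= C * `|v|) ->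
  norm1 (iter k (mulmx^~ (cplx (F s))) u) <= C2 * norm1 u.
Proof.
move=> bF; rewrite iter_cplx (le_trans (norm1_decomp _ _))// /C2 -mulrA.
have bd v w : `|v| <= w -> `|iter k (F s) v| <= `|C| * w.
  move=> vw; apply: (le_trans (bF _ _)); apply: (@le_trans _ _ (`|C| * `|v|)).
    by apply: ler_wpM2r => //; exact: ler_norm.
  exact: ler_wpM2l.
by apply: ler_wpM2l => //; rewrite mulrDl lerD ?bd.
Qed.

Let iter_mulmxD (A : 'M[R[i]]_n) k (u v : EC) :
  iter k (mulmx^~ A) (u + v) = iter k (mulmx^~ A) u + iter k (mulmx^~ A) v.
Proof. by elim: k => //= k ->; rewrite mulmxDl. Qed.

Let iter_mulmxZ (A : 'M[R[i]]_n) k (a : R[i]) (u : EC) :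
  iter k (mulmx^~ A) (a *: u) = a *: iter k (mulmx^~ A) u.
Proof. by elim: k => //= k ->; rewrite scalemxAl. Qed.

(** When q is larger than 1 in modulus and u is nearly an eigenvector of F s for
q, the iterates of F s on u follow the powers of q, with an error that grows at
the same rate as these powers but is proportional to the initial defect. *)
Lemma geometric_growth s (u : EC) (q : R[i]) :
  (forall k v, `|iter k (F s) v| <= C * `|v|) -> 1 <= normc q -> forall k,
  norm1 (iter k (mulmx^~ (cplx (F s))) u - q ^+ k *: u) * (normc q - 1) <=
    C2 * norm1 (u *m cplx (F s) - q *: u) * (normc q ^+ k - 1).
Proof.
move=> bF q1; have q0 : 0 <= normc q by exact: normc_ge0.
have q10 : 0 <= normc q - 1 by rewrite subr_ge0.
elim=> [|k IH].
  by rewrite /= !expr0 scale1r !subrr norm1_0 mul0r mulr0.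
set w := u *m _ - _ *: _ in IH *.
have -> : iter k.+1 (mulmx^~ (cplx (F s))) u - q ^+ k.+1 *: u =
    iter k (mulmx^~ (cplx (F s))) w +
    q *: (iter k (mulmx^~ (cplx (F s))) u - q ^+ k *: u).
  have -> : iter k (mulmx^~ (cplx (F s))) w = iter k.+1 (mulmx^~ (cplx (F s))) u -
      q *: iter k (mulmx^~ (cplx (F s))) u.
    by rewrite /w -scaleNr iter_mulmxD iter_mulmxZ scaleNr iterSr.
  by rewrite scalerBr scalerA -exprS addrA subrK.
have h1 := pow_bound k w bF.
have h2 := norm1D (iter k (mulmx^~ (cplx (F s))) w)
  (q *: (iter k (mulmx^~ (cplx (F s))) u - q ^+ k *: u)).
rewrite norm1Z in h2.
set x := norm1 (_ + _) in h2 *; set y := norm1 (iter _ _ w) in h1 h2.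
set z := norm1 (_ - _) in IH h2; set W := C2 * norm1 w in h1 IH *.
rewrite exprS; set p := normc q ^+ k in IH *; set r := normc q in q0 q10 h2 IH *.
have : x * (r - 1) <= (W + r * z) * (r - 1).
  by apply: ler_wpM2r => //; apply: (le_trans h2); rewrite lerD.
have : r * (z * (r - 1)) <= r * (W * (p - 1)) by exact: ler_wpM2l.
lra.
Qed.


Let combine_cplx (V : lmodType R[i]) (i r : R[i]) (a1 a2 b1 b2 c1 c2 : V) :
  a1 + i *: a2 - (b1 + i *: b2) - r *: (c1 + i *: c2) =
  a1 - b1 - r *: c1 + i *: (a2 - b2 - r *: c2).
Proof.
rewrite !(scalerBr, scalerDr) !scalerA (mulrC r) !opprD.
by rewrite (addrACA a1) (addrACA (a1 - b1)).
Qed.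

Let F_expansion (u : EC) e : 0 < e -> \forall s \near 0^',
  norm1 (u *m cplx (F s) - u - rc s *: (u *m cplx f)) <= e * `|s|.
Proof.
move=> e0; pose e' := e / ((n%:R + 1) * 2).
have n1 : 0 < n%:R + 1 :> R by rewrite ltr_wpDl.
have e'0 : 0 < e' by rewrite divr_gt0// mulr_gt0.
have est v : \forall s \near 0^', `|F s v - v - s *: f v| <= e' * `|s|.
  have /cvgrPdist_le/(_ _ e'0) := @F_derivative v.
  apply: filter_app; near=> s => h.
  have s0 : s != 0 by near: s; exact: nbhs_dnbhs_neq.
  have -> : F s v - v - s *: f v = - s *: (f v - s^-1 *: (F s v - v)).
    by rewrite scalerBr !scaleNr scalerA mulfV// scale1r opprK addrC.
  by rewrite normrZ normrN mulrC ler_wpM2r.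
near=> s.
have ha : `|F s (rowRe u) - rowRe u - s *: f (rowRe u)| <= e' * `|s|.
  by near: s; exact: est.
have hb : `|F s (rowIm u) - rowIm u - s *: f (rowIm u)| <= e' * `|s|.
  by near: s; exact: est.
have -> : u *m cplx (F s) - u - rc s *: (u *m cplx f) =
    map_mx rc (F s (rowRe u) - rowRe u - s *: f (rowRe u)) +
    (0 +i* 1)%C *: map_mx rc (F s (rowIm u) - rowIm u - s *: f (rowIm u)).
  by rewrite !cplxE [X in _ - X - _]decomp !map_mxB !map_mxZ combine_cplx.
apply: (le_trans (norm1_decomp _ _)).
apply: (@le_trans _ _ (n%:R * (e' * `|s| + e' * `|s|))).
  by apply: ler_wpM2l => //; rewrite lerD.
rewrite -mulr2n -(mulr_natr (e' * _)) /e'.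
have -> : e * `|s| = (n%:R + 1) * (e / ((n%:R + 1) * 2) * `|s| * 2).
  by field; rewrite gt_eqF.
apply: ler_wpM2r; last by rewrite lerDl.
by rewrite !mulr_ge0// ltW.
Unshelve. all: by end_near. Qed.

(** This is the Hille-Yosida estimate for the generator f.  If u is nearly an
eigenvector of f for z then it is nearly one of F s for q = 1 + s z, and for s of
the sign of Re z the powers of q grow, which power boundedness forbids unless the
defect is at least of the order of Re z. *)
Lemma resolvent_bound (u : EC) (z : R[i]) :
  `|complex.Re z| * norm1 u <= C2 * norm1 (u *m cplx f - z *: u).
Proof.
have [->|z0] := eqVneq (complex.Re z) 0.
  by rewrite normr0 mul0r mulr_ge0// norm1_ge0.
set r := norm1 (_ - _); apply/ler_addgt0Pr => e' e'0.
pose e := e' / (C2 + 1).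
have C21 : 0 < C2 + 1 by rewrite ltr_wpDl.
have e0 : 0 < e by rewrite divr_gt0.
apply: (@le_trans _ _ (C2 * (r + e))); last first.
  rewrite mulrDr lerD2l /e mulrA ler_pdivrMr// [leRHS]mulrDr mulr1 mulrC.
  by rewrite lerDl ltW.
have [d /= d0 ball_d] := F_expansion u e0.
have [d' /= d'0 ball_d'] := F_power_bounded.
(* The sign of s makes q larger than 1 in modulus. *)
pose s := Num.sg (complex.Re z) * (Num.min d d' / 2).
have dd' : 0 < Num.min d d' by rewrite lt_min d0.
have s0 : s != 0 by rewrite mulf_neq0 ?sgr_eq0// gt_eqF// divr_gt0.
have ns : `|s| = Num.min d d' / 2.
  by rewrite normrM normr_sg z0 mul1r ger0_norm// divr_ge0// ltW.
have ltsd : `|s| < d.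
  have : Num.min d d' <= d by rewrite ge_min lexx.
  rewrite ns; lra.
have ltsd' : `|s| < d'.
  have : Num.min d d' <= d' by rewrite ge_min lexx orbT.
  rewrite ns; lra.
have bs := ball_d s; rewrite /= sub0r normrN in bs; have {}bs := bs ltsd s0.
have bF := ball_d' s; rewrite /= sub0r normrN in bF; have {}bF := bF ltsd' s0.
pose q := 1 + rc s * z.
have hq : `|s| * `|complex.Re z| <= normc q - 1.
  rewrite lerBrDr -normrM.
  have -> : `|s * complex.Re z| = s * complex.Re z.
    by rewrite ger0_norm// /s mulrAC -normrEsg mulr_ge0// divr_ge0// ltW.
  rewrite (le_trans _ (normc_ge_Re _))// (le_trans _ (ler_norm _))//.
  by rewrite /q addrC; case: (z) => a b /=; rewrite mul0r subr0.
have s0' : 0 < `|s| by rewrite normr_gt0.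
have h0 : 0 < `|s| * `|complex.Re z| by rewrite mulr_gt0// normr_gt0.
have q1 : 1 < normc q by rewrite -subr_gt0 (lt_le_trans h0).
have hw : norm1 (u *m cplx (F s) - q *: u) <= `|s| * (r + e).
  have -> : u *m cplx (F s) - q *: u = rc s *: (u *m cplx f - z *: u) +
      (u *m cplx (F s) - u - rc s *: (u *m cplx f)).
    rewrite scalerBr scalerA /q scalerDl scale1r [RHS]addrC.
    by rewrite opprD !addrA subrK.
  apply: (le_trans (norm1D _ _)); rewrite norm1Z normc_real mulrDr -/r.
  by rewrite lerD// mulrC.
rewrite leNgt; apply/negP => gap.
have key k : normc q ^+ k * (`|complex.Re z| * norm1 u - C2 * (r + e)) <=
    `|complex.Re z| * (C2 + 1) * norm1 u.
  have hg := geometric_growth u bF (ltW q1) k.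
  have hp := pow_bound k u bF.
  set x := norm1 (_ - _) in hg.
  have hx : normc q ^+ k * norm1 u <= x + C2 * norm1 u.
    have -> : normc q ^+ k = normc (q ^+ k).
      by elim: (k) => [|j IH]; rewrite ?expr0 ?Normc.normc1// !exprS Normc.normcM IH.
    rewrite -norm1Z; apply: le_trans (lerD (lexx _) hp).
    rewrite /x; set a := iter _ _ _.
    have {1}-> : q ^+ k *: u = rc (-1) *: (a - q ^+ k *: u) + a.
      by rewrite rmorphN1 scaleN1r opprB subrK.
    by apply: (le_trans (norm1D _ _)); rewrite norm1Z normc_real normrN1 mul1r.
  have x0 : 0 <= x by exact: norm1_ge0.
  have N0 : 0 <= norm1 u by exact: norm1_ge0.
  have p1 : 1 <= normc q ^+ k by rewrite exprn_ege1// ltW.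
  have h1 : x * (`|s| * `|complex.Re z|) <= x * (normc q - 1) by exact: ler_wpM2l.
  have h2 : C2 * norm1 (u *m cplx (F s) - q *: u) * (normc q ^+ k - 1) <=
      C2 * (`|s| * (r + e)) * normc q ^+ k.
    apply: ler_pM; rewrite ?mulr_ge0 ?norm1_ge0 ?subr_ge0//.
    - exact: ler_wpM2l.
    - by rewrite gerBl.
  have h3 : x * `|complex.Re z| <= C2 * (r + e) * normc q ^+ k.
    rewrite -(ler_pM2l s0') [leLHS]mulrCA (le_trans h1)//.
    by rewrite (le_trans hg)// (le_trans h2)// mulrCA !mulrA.
  have h4 : `|complex.Re z| * (normc q ^+ k * norm1 u) <=
      `|complex.Re z| * (x + C2 * norm1 u) by exact: ler_wpM2l.
  have : 0 <= `|complex.Re z| * norm1 u by exact: mulr_ge0.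
  set Z := `|_| in h3 h4 *; set p := normc q ^+ k in p1 h2 h3 h4 *.
  set N := norm1 u in N0 h4 *; move: h3 h4; lra.
set X := _ - _ in key; have X0 : 0 < X by rewrite subr_gt0.
set B := _ * norm1 u in key.
(* Bernoulli's inequality makes the left-hand side of key unbounded. *)
have bern k : 1 + k%:R * (normc q - 1) <= normc q ^+ k.
  elim: k => [|k IH]; first by rewrite mul0r addr0 expr0.
  rewrite exprS; have : normc q * (1 + k%:R * (normc q - 1)) <= normc q * normc q ^+ k.
    by apply: ler_wpM2l => //; exact: normc_ge0.
  have : 0 <= k%:R * (normc q - 1) * (normc q - 1).
    by rewrite !mulr_ge0// subr_ge0 ltW.
  rewrite -natr1; lra.
have q10 : 0 < (normc q - 1) * X by rewrite mulr_gt0// subr_gt0.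
pose k := (Num.trunc (`|B| / ((normc q - 1) * X))).+1.
have : `|B| < k%:R * ((normc q - 1) * X).
  by rewrite -ltr_pdivrMr// truncnS_gt.
apply/negP; rewrite -leNgt; apply: le_trans (ler_norm B).
apply: le_trans (key k); have := bern k; rewrite -(ler_pM2r X0) => h; apply: (le_trans _ h).
by rewrite [leRHS]mulrDl mul1r mulrA lerDr ltW.
Qed.

Let nonreal_eigen (z : R[i]) (u : EC) :
  u *m cplx f = z *: u -> u != 0 -> complex.Re z = 0.
Proof.
move=> fu; apply: contra_neq_eq => z0; apply: norm1_eq0.
have := resolvent_bound u z; rewrite fu subrr.
rewrite norm1_0 mulr0.
rewrite pmulr_rle0 ?normr_gt0// => N0.
by apply/eqP; rewrite eq_le N0 norm1_ge0.
Qed.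

Let shift_identity (V : lmodType R[i]) (z k : R[i]) (v w : V) : k != 0 ->
  v + z *: w + k^-1 *: (z *: v) - (z + k) *: (w + k^-1 *: v) = - k *: w.
Proof.
move=> k0; rewrite scalerDl !scalerDr !scalerA mulfV// scale1r (mulrC z k^-1).
rewrite -(addrA v) (addrC v); set a := _ + _ *: v.
rewrite (_ : _ + (_ + v) = a + (k *: w + v)); last by rewrite addrACA.
by rewrite opprD addrACA subrr add0r opprD addrCA subrr addr0 scaleNr.
Qed.

(** If w generated a Jordan block of size 2 over v, then w + v / e would be an
approximate eigenvector for z + e with defect e times the norm of w, while its
norm is of the order 1 / e: this contradicts the resolvent bound as e tends
to 0. *)
Let semisimple_eigen (z : R[i]) (w : EC) :
  complex.Re z = 0 -> (w *m cplx f - z *: w) *m cplx f = z *: (w *m cplx f - z *: w) ->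
  w *m cplx f = z *: w.
Proof.
move=> z0; set v := _ - _ => fv.
suff : norm1 v = 0 by move/norm1_eq0/eqP; rewrite subr_eq0 => /eqP.
apply/eqP; rewrite eq_le norm1_ge0 andbT.
have key (e : R) : 0 < e -> norm1 v <= e * ((C2 + 1) * norm1 w).
  move=> e0; have := resolvent_bound (w + rc e^-1 *: v) (z + rc e).
  have -> : complex.Re (z + rc e) = e.
    by move: z0; case: (z) => a b /= ->; rewrite add0r.
  have rce : rc e != 0 by rewrite fmorph_eq0 gt_eqF.
  have -> : (w + rc e^-1 *: v) *m cplx f - (z + rc e) *: (w + rc e^-1 *: v) =
      - rc e *: w.
    rewrite mulmxDl -scalemxAl fv -[w *m cplx f](subrK (z *: w)) -/v.
    by rewrite fmorphV/= shift_identity.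
  have -> : norm1 (- rc e *: w) = e * norm1 w.
    by rewrite -rmorphN norm1Z normc_real normrN gtr0_norm.
  have hv : norm1 v <= e * (norm1 (w + rc e^-1 *: v) + norm1 w).
    have vE : v = rc e *: (w + rc e^-1 *: v) + rc (- 1) *: (rc e *: w).
      rewrite scalerDr !scalerA -!rmorphM mulfV ?gt_eqF// scale1r mulN1r.
      by rewrite rmorphN scaleNr addrAC subrr add0r.
    have := norm1D (rc e *: (w + rc e^-1 *: v)) (rc (-1) *: (rc e *: w)).
    by rewrite -vE !norm1Z !normc_real normrN1 mul1r gtr0_norm// mulrDr.
  rewrite gtr0_norm// => h.
  by rewrite (le_trans hv)// mulrDr; move: h; lra.
rewrite leNgt; apply/negP => v0.
pose B := (C2 + 1) * norm1 w.
have B0 : 0 <= B by rewrite mulr_ge0 ?norm1_ge0// addr_ge0.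
have := key (norm1 v / (2 * (B + 1))); rewrite divr_gt0 ?mulr_gt0 ?ltr_wpDl// => /(_ isT).
rewrite -/B mulrAC ler_pdivlMr ?mulr_gt0 ?ltr_wpDl// ler_pM2l//; lra.
Qed.

Lemma elliptic_of_power_bounded : elliptic f.
Proof.
split.
  apply: diagonalizable_semisimple => z w.
  have [z0|z0] := eqVneq (complex.Re z) 0; first exact: semisimple_eigen.
  move=> h; apply/eqP; rewrite -subr_eq0; apply/negPn/negP => v0.
  by move/eqP: z0; apply; exact: nonreal_eigen h v0.
by move=> z /eigenvalueP[v fv v0]; exact: nonreal_eigen fv v0.
Qed.
End elliptic_criterion.

(** * Mean values and mixed second derivatives *)

Section calculus.
Context {R : realType}.

Lemma mean_value_le n (f : R -> 'rV[R]_n) (C : R) :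
  (forall t : R, 0 <= t <= 1 -> derivable f t 1) ->
  (forall t : R, 0 <= t <= 1 -> `|'D_1 f t| <= C) -> `|f 1 - f 0| <= C.
Proof.
move=> df bf.
have C0 : 0 <= C by apply: le_trans (bf 0 _) => //; rewrite lexx ler01.
rewrite [leLHS]mx_normrE; apply: bigmax_le => // -[i j] _ /=.
rewrite (ord1 i) !mxE {i}; pose g : R -> R := fun t : R => f t ord0 j.
rewrite -[f 1 _ _]/(g 1) -[f 0 _ _]/(g 0).
have dg (t : R) : t \in `[0, 1] -> is_derive t 1 g ('D_1 f t ord0 j).
  rewrite in_itv /= => /df dft; rewrite derive_mx// mxE.
  by apply: derivableP; move/derivable_mxP : dft; exact.
have dg' (t : R) : t \in `]0, 1[ -> is_derive t 1 g ('D_1 f t ord0 j).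
  by move=> t01; apply: dg; move: t01; rewrite !in_itv /= => /andP[/ltW-> /ltW->].
have cg : {within `[0, 1], continuous g}.
  apply: derivable_within_continuous => t t01.
  by have /@ex_derive := dg t t01.
have [c c01 e] := MVT_segment ler01 dg' cg.
rewrite e subr0 mulr1; apply: le_trans (bf c _); last by move: c01; rewrite in_itv.
exact: coord_norm_le.
Qed.

Lemma differentiable_expansion (V W : normedModType R) (f : V -> W) a :
  differentiable f a -> forall e, 0 < e ->
  \forall h \near (0 : V), `|f (a + h) - f a - 'd f a h| <= e * `|h|.
Proof.
move=> df e e0; have := diff_locally df => /eqaddoP/(_ _ e0).
by apply: filterS => h; rewrite /= !fctE /= opprD addrA [h + a]addrC.
Qed.

Lemma derive_lineE (V W : normedModType R) (f : V -> W) p u t :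
  (fun h : R => h^-1 *: ((f (p + (h *: (1 : R) + t) *: u)) - f (p + t *: u))) =
  (fun h : R => h^-1 *: (f (h *: u + (p + t *: u)) - f (p + t *: u))).
Proof.
apply/funext => h; congr (_ *: (f _ - _)).
by rewrite scalerDl [h *: 1]mulr1 addrCA.
Qed.

Lemma is_derive_line (V W : normedModType R) (f : V -> W) p u (t : R) :
  differentiable f (p + t *: u) ->
  is_derive t (1 : R) (fun s : R => f (p + s *: u)) ('D_u f (p + t *: u)).
Proof.
move=> df; have dfu := @diff_derivable _ _ _ _ _ u df.
apply: DeriveDef.
  by rewrite /derivable /= derive_lineE.
by rewrite /derive /= derive_lineE.
Qed.

Lemma cvg_curve (V W : normedModType R) (f : V -> W) (p : R -> V) d :
  is_derive (0 : R) (1 : R) p d -> differentiable f (p 0) ->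
  s^-1 *: (f (p s) - f (p 0)) @[s --> 0^'] --> 'D_d f (p 0).
Proof.
move=> dp df.
have p1 : differentiable p 0 by apply/derivable1_diffP; exact: ex_derive.
have fp : differentiable (f \o p) 0 by exact: differentiable_comp.
have -> : 'D_d f (p 0) = 'D_1 (f \o p) 0.
  have <- : 'd p (0 : R) (1 : R) = d by rewrite -deriveE// derive_val.
  by rewrite (deriveE _ df) (deriveE _ fp) (diff_comp p1 df).
have := @diff_derivable _ _ _ _ _ (1 : R) fp.
rewrite /derivable /derive /=; under eq_fun do rewrite addr0 [_ *: 1]mulr1.
done.
Qed.

Lemma diff_norm_le (V W : normedModType R) (f : V -> W) o C v :
  differentiable f o -> (\forall x \near o, `|f x - f o| <= C * `|x - o|) ->
  `|'d f o v| <= C * `|v|.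
Proof.
move=> df bf; apply/ler_addgt0Pr => e e0.
have := @diff_derivable _ _ _ _ _ v df; rewrite /derivable -(deriveE v df) /derive.
set F := (X in cvg X); move/cvgrPdist_le => /(_ _ e0) nearF.
have nearo : \forall h \near 0^', `|f (h *: v + o) - f o| <= C * `|h *: v + o - o|.
  have cv : h *: v + o @[h --> (0 : R)^'] --> 0 *: v + o.
    apply: cvg_within_filter.
    exact: (cvgD (cvgZr_tmp (@cvg_id _ (nbhs (0 : R)))) (cvg_cst o)).
  rewrite scale0r add0r in cv.
  exact: (cv _ bf).
near (0 : R)^' => h.
have h0 : h != 0 by near: h; exact: nbhs_dnbhs_neq.
have h1 : `|f (h *: v + o) - f o| <= C * `|h *: v| by rewrite -[X in _ <= _ * `|X|](addrK o); near: h.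
have h2 : `|lim F - h^-1 *: (f (h *: v + o) - f o)| <= e by near: h.
rewrite -[lim F](subrK (h^-1 *: (f (h *: v + o) - f o))).
rewrite (le_trans (ler_normD _ _))// addrC lerD// normrZ normfV.
by rewrite ler_pdivrMl ?normr_gt0// (le_trans h1)// normrZ mulrCA.
Unshelve. all: by end_near. Qed.

(** At a fixed point the chain rule can be iterated. *)
Lemma diff_iter (V : normedModType R) (f : V -> V) o : f o = o ->
  differentiable f o -> forall k,
  differentiable (iter k f) o /\ forall v, 'd (iter k f) o v = iter k ('d f o) v.
Proof.
move=> fo df; elim=> [|k [dk IH]].
  have -> : iter 0 f = id by [].
  by split=> [|v]; [exact: ex_diff|rewrite diff_val].
have ko : iter k f o = o by elim: (k) => //= j ->.
have -> : iter k.+1 f = f \o iter k f by apply/funext.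
have df' : differentiable f (iter k f o) by rewrite ko.
split=> [|v]; first exact: differentiable_comp.
have e : 'd (f \o iter k f) o v = 'd f (iter k f o) ('d (iter k f) o v).
  by rewrite (diff_comp dk df').
rewrite e IH iterS.
by rewrite ko.
Qed.

Section symmetry.
Variables (V : normedModType R) (n : nat) (f : V -> 'rV[R]_n) (a : V).
Hypothesis df : \forall x \near a, differentiable f x.

(** The second difference, which is symmetric in u and v. *)
Let Delta u v (h : R) := f (a + h *: u + h *: v) - f (a + h *: u) - f (a + h *: v) + f a.

Let DeltaC u v h : Delta u v h = Delta v u h.
Proof. by rewrite /Delta (addrAC a) -!addrA; congr (_ + _); rewrite addrCA. Qed.

Let four_terms (U : zmodType) (x y z t w : U) :
  x - y - z + t - w = x - y - w - (z - t).
Proof.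
rewrite opprB -!addrA; congr (_ + (_ + _)).
by rewrite addrC -addrA [RHS]addrCA.
Qed.

Let difference_terms (U : zmodType) (x y z t w : U) :
  x - y - (t - w) = (x - z - t) - (y - z - w).
Proof.
have -> : x - y = (x - z) - (y - z) by rewrite opprB addrA subrK.
by rewrite !opprD !opprK addrACA.
Qed.

(** The mean value inequality, applied to the increment of f in the direction
h v along the segment from a to a + h u, reduces the second difference to
increments of 'D_u f, which its differentiability at a controls. *)
Let Delta_estimate u v e : differentiable ('D_u f) a -> 0 < e ->
  \forall h \near (0 : R)^'+, `|Delta u v h - (h * h) *: 'D_v ('D_u f) a| <= e * (h * h).
Proof.
move=> dDu e0; pose M := 2 * (`|u| + `|v|) + 1.
have M0 : 0 < M by rewrite ltr_wpDl// mulr_ge0// addr_ge0.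
have e'0 : 0 < e / M by rewrite divr_gt0.
have nearD := differentiable_expansion dDu e'0.
have /nbhs_ballP[r /= r0 ball_r] : \forall k \near (0 : V), differentiable f (a + k) /\
    `|'D_u f (a + k) - 'D_u f a - 'd ('D_u f) a k| <= e / M * `|k|.
  near=> k; split; last by near: k.
  near: k; have cv : a + k @[k --> (0 : V)] --> a + 0.
    exact: (cvgD (cvg_cst a) (@cvg_id _ (nbhs (0 : V)))).
  rewrite addr0 in cv.
  exact: (cv _ df).
near=> h.
have h0 : 0 < h by near: h; exact: nbhs_right_gt.
have hr : h * M < r by rewrite -ltr_pdivlMr//; near: h; apply: nbhs_right_lt; rewrite divr_gt0.
set A := 'D_v _ _.
have small (t b : R) : 0 <= t <= 1 -> 0 <= b <= 1 ->
    `|(h * t) *: u + (h * b) *: v| <= h * (`|u| + `|v|).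
  move=> /andP[t0 t1] /andP[b0 b1].
  rewrite (le_trans (ler_normD _ _))// -!scalerA.
  rewrite (normrZ h) (normrZ h (b *: v)) (gtr0_norm h0) -mulrDr ler_pM2l//.
  by rewrite (normrZ t) (normrZ b) !ger0_norm// lerD// ler_piMl.
have inball (t b : R) : 0 <= t <= 1 -> 0 <= b <= 1 ->
    differentiable f (a + ((h * t) *: u + (h * b) *: v)) /\
    `|'D_u f (a + ((h * t) *: u + (h * b) *: v)) - 'D_u f a -
      'd ('D_u f) a ((h * t) *: u + (h * b) *: v)| <=
      e / M * `|(h * t) *: u + (h * b) *: v|.
  move=> t01 b01; apply: ball_r; rewrite -ball_normE /= sub0r normrN.
  apply: le_lt_trans (small _ _ t01 b01) _; apply: le_lt_trans hr.
  by rewrite ler_pM2l// /M; have := normr_ge0 u; have := normr_ge0 v; lra.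
have i0 : (0 : R) <= (0 : R) <= (1 : R) by rewrite lexx ler01.
have i1 : (0 : R) <= (1 : R) <= (1 : R) by rewrite lexx ler01.
pose w := (h * h) *: A.
pose phi := fun t : R => f ((a + h *: v) + t *: (h *: u)) - f (a + t *: (h *: u)) -
  id (0 + t *: w).
pose dphi := fun t : R => h *: ('D_u f (a + ((h * t) *: u + (h * 1) *: v)) -
  'D_u f (a + ((h * t) *: u + (h * 0) *: v)) - h *: A).
have pt t : a + h *: v + t *: (h *: u) = a + ((h * t) *: u + (h * 1) *: v).
  by rewrite mulr1 scalerA (mulrC t) addrAC addrA.
have pt0 t : a + t *: (h *: u) = a + ((h * t) *: u + (h * 0) *: v).
  by rewrite mulr0 scale0r addr0 scalerA (mulrC t).
have dphiP (t : R) : 0 <= t <= 1 -> is_derive t (1 : R) phi (dphi t).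
  move=> t01; have [df1 _] := inball _ _ t01 i1; have [df0 _] := inball _ _ t01 i0.
  have -> : dphi t = 'D_(h *: u) f (a + h *: v + t *: (h *: u)) -
      'D_(h *: u) f (a + t *: (h *: u)) - 'D_w id (0 + t *: w).
    rewrite pt pt0 !deriveE// !linearZ /= -!deriveE// derive_id /dphi.
    by rewrite !(scalerBr, scalerN) scalerA.
  apply: is_deriveB; last by apply: is_derive_line; exact: ex_diff.
  by apply: is_deriveB; apply: is_derive_line; rewrite ?pt ?pt0.
have -> : Delta u v h - w = phi 1 - phi 0.
  rewrite /phi !scale1r !scale0r !addr0 !add0r subr0 /Delta four_terms.
  by rewrite (addrAC a).
apply: mean_value_le => t t01; first by have /@ex_derive := dphiP t t01.
have -> : 'D_1 phi t = dphi t by have /@derive_val := dphiP t t01.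
rewrite /dphi normrZ (gtr0_norm h0) [leRHS]mulrCA ler_pM2l//.
pose k (b : R) := (h * t) *: u + (h * b) *: v.
have e1 : `|'D_u f (a + k 1) - 'D_u f a - 'd ('D_u f) a (k 1)| <= e / M * `|k 1|.
  exact: (inball _ _ t01 i1).2.
have e2 : `|'D_u f (a + k 0) - 'D_u f a - 'd ('D_u f) a (k 0)| <= e / M * `|k 0|.
  exact: (inball _ _ t01 i0).2.
have -> : h *: A = 'd ('D_u f) a (k 1) - 'd ('D_u f) a (k 0).
  rewrite -linearB /A deriveE// -linearZ; congr ('d _ _ _).
  by rewrite /k mulr0 mulr1 scale0r addr0 addrAC subrr add0r.
rewrite -/(k 1) -/(k 0) (difference_terms _ _ ('D_u f a)).
rewrite (le_trans (ler_normB _ _))// (le_trans (lerD e1 e2))// -mulrDr.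
have hk : `|k 1| + `|k 0| <= h * M.
  apply: (le_trans (lerD (small _ _ t01 i1) (small _ _ t01 i0))).
  by rewrite -mulrDr ler_pM2l// /M; lra.
rewrite (@le_trans _ _ (e / M * (h * M)))//; first by rewrite ler_wpM2l// ltW.
by rewrite mulrCA divfK ?gt_eqF// mulrC.
Unshelve. all: by end_near. Qed.

Let two_approximations (W : normedModType R) (X A B : W) (s b : R) :
  `|X - s *: A| <= b -> `|X - s *: B| <= b -> `|s *: (A - B)| <= b + b.
Proof.
move=> hA hB; have -> : s *: (A - B) = (X - s *: B) - (X - s *: A).
  by rewrite scalerBr opprB [RHS]addrC addrA subrK.
by rewrite (le_trans (ler_normB _ _))// lerD.
Qed.

(** Young's theorem: both mixed derivatives are the limit of the second
difference divided by the square of h. *)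
Lemma derive_symmetric u v : differentiable ('D_u f) a -> differentiable ('D_v f) a ->
  'D_v ('D_u f) a = 'D_u ('D_v f) a.
Proof.
move=> du dv; apply/eqP; rewrite -subr_eq0 -normr_le0; apply/ler_addgt0Pr => e e0.
have e20 : 0 < e / 2 by rewrite divr_gt0.
have n1 := Delta_estimate v du e20; have n2 := Delta_estimate u dv e20.
have [r1 /= r10 b1] := n1; have [r2 /= r20 b2] := n2.
pose h := Num.min r1 r2 / 2.
have h0 : 0 < h by rewrite divr_gt0// lt_min r10.
have hr1 : h < r1.
  rewrite /h; have : Num.min r1 r2 <= r1 by rewrite ge_min lexx.
  by move: h0; rewrite /h; lra.
have hr2 : h < r2.
  rewrite /h; have : Num.min r1 r2 <= r2 by rewrite ge_min lexx orbT.
  by move: h0; rewrite /h; lra.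
have h1 : `|Delta u v h - (h * h) *: 'D_v ('D_u f) a| <= e / 2 * (h * h).
  by apply: b1 => //=; rewrite sub0r normrN gtr0_norm.
have h2 : `|Delta v u h - (h * h) *: 'D_u ('D_v f) a| <= e / 2 * (h * h).
  by apply: b2 => //=; rewrite sub0r normrN gtr0_norm.
have hh0 : 0 < h * h by rewrite mulr_gt0.
rewrite add0r -(ler_pM2l hh0) -{1}(gtr0_norm hh0) -normrZ.
rewrite (DeltaC v u) in h2; apply: le_trans (two_approximations h1 h2) _.
by rewrite -mulrDl -splitr mulrC.
Qed.

End symmetry.
End calculus.

(** * Coordinate balls around the identity *)

Section topological_group.
Context {R : realType} {n : nat} {G : lieGroupType R n}.
Local Notation E := 'rV[R]_n.
Local Notation c := (chart1 G).
Local Notation o := (origin G).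

Lemma cvg_mulg (T : Type) (F : set_system T) {FF : Filter F}
    (f g : T -> G) (a b : G) :
  f @ F --> a -> g @ F --> b -> (f x * g x)%g @[x --> F] --> (a * b)%g.
Proof.
move=> fa gb.
apply: (@cvg_comp _ _ _ (fun x => (f x, g x)) (fun p : G * G => (p.1 * p.2)%g));
  last exact: (lie_mul_continuous (a, b)).
by apply: cvg_pair.
Qed.

Lemma cvg_invg (T : Type) (F : set_system T) {FF : Filter F}
    (f : T -> G) (a : G) :
  f @ F --> a -> (f x)^-1%g @[x --> F] --> (a^-1)%g.
Proof.
move=> fa; apply: (@cvg_comp _ _ _ f (fun x => (x^-1)%g));
  last exact: (lie_inv_continuous a).
exact: fa.
Qed.

Lemma chart1_dom1 : chart_dom c 1%g. Proof. exact: chart_at_dom. Qed.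

Lemma chart1_codo : chart_cod c o. Proof. exact/chart_mapP/chart1_dom1. Qed.

Lemma chart1_invo : chart_inv c o = 1%g. Proof. exact/chart_mapK/chart1_dom1. Qed.

Definition coord_ball (r : R) : set G :=
  [set g | chart_dom c g /\ `|chart_map c g - o| < r].
Definition coord_cball (r : R) : set G :=
  [set g | chart_dom c g /\ `|chart_map c g - o| <= r].
Definition coord_sphere (r : R) : set G :=
  [set g | chart_dom c g /\ `|chart_map c g - o| = r].

Lemma open_coord_ball r : open (coord_ball r).
Proof.
rewrite openE => g [gd gr].
have lim_dist : `|chart_map c h - o| @[h --> g] --> `|chart_map c g - o|.
  apply: cvg_norm; apply: cvgB; [exact: chart_map_continuous|exact: cvg_cst].
near=> h; split; near: h; last exact: (cvgr_lt _ lim_dist).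
by apply: open_nbhs_nbhs; split=> //; exact: chart_dom_open.
Unshelve. all: by end_near. Qed.

Lemma nbhs_coord_ball r : 0 < r -> nbhs (1%g : G) (coord_ball r).
Proof.
move=> r0; apply: open_nbhs_nbhs; split; first exact: open_coord_ball.
by split; [exact: chart1_dom1|rewrite subrr normr0].
Qed.

(** For such radii r the inverse chart maps the whole closed r-ball of coordinate
space onto coord_cball r, which makes the latter compact. *)
Lemma near0_cball_cod : \forall r \near 0^'+,
  forall x : E, `|x - o| <= r -> chart_cod c x.
Proof.
have /nbhs_ballP[e /= e0 be] : nbhs o (chart_cod c).
  by apply: open_nbhs_nbhs; split; [exact: chart_cod_open|exact: chart1_codo].
near=> r => x xr; apply: be; rewrite -ball_normE /= distrC.
by apply: (le_lt_trans xr); near: r; exact: nbhs_right_lt.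
Unshelve. all: by end_near. Qed.

Section admissible.
Variable r : R.
Hypothesis radm : forall x : E, `|x - o| <= r -> chart_cod c x.

Lemma cball_image : coord_cball r = chart_inv c @` [set x | `|x - o| <= r].
Proof.
apply/seteqP; split=> [g [gd gr]|_ [x /= xr <-]].
  by exists (chart_map c g) => //; exact: chart_mapK.
by split; [apply: chart_invP; exact: radm|rewrite chart_invK//; exact: radm].
Qed.

Lemma compact_vball : compact [set x : E | `|x - o| <= r].
Proof.
apply: bounded_closed_compact.
  exists (`|o| + r); split; first exact: num_real.
  move=> M Mr x /= xr; rewrite -(subrK o x); apply: le_trans (ler_normD _ _) _.
  by rewrite addrC (le_trans _ (ltW Mr))// lerD2l.
rewrite (_ : [set x | _] = (fun x => `|x - o|) @^-1` [set y | y <= r])//.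
have cf : continuous (fun x : E => `|x - o|).
  by move=> x; exact: (cvg_norm (cvgB (@cvg_id _ (nbhs x)) (cvg_cst o))).
by move/continuous_closedP : cf; apply; exact: closed_le.
Qed.

Lemma compact_coord_cball : compact (coord_cball r).
Proof.
rewrite cball_image; apply: continuous_compact; last exact: compact_vball.
apply/continuous_in_subspaceT => x; rewrite inE /= => xr.
by apply: chart_inv_continuous; exact: radm.
Qed.

Lemma closed_coord_cball : closed (coord_cball r).
Proof. exact: (compact_closed manifold_hausdorff compact_coord_cball). Qed.

Lemma compact_coord_sphere : compact (coord_sphere r).
Proof.
apply: subclosed_compact compact_coord_cball _; last by move=> g [gd /eqP]; rewrite eq_le => /andP[].
rewrite (_ : coord_sphere r = coord_cball r `&` ~` coord_ball r).
  apply: closedI; first exact: closed_coord_cball.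
  by apply: open_closedC; exact: open_coord_ball.
apply/seteqP; split=> g /=.
  by move=> [gd gr]; split; [split=> //; rewrite gr|move=> [_]; rewrite gr ltxx].
move=> [[gd gr] ng]; split=> //; apply/eqP; rewrite eq_le gr /= leNgt.
by apply/negP => h; apply: ng.
Qed.

Lemma connected_coord_ball : connected (coord_ball r).
Proof.
have -> : coord_ball r = \bigcup_(x in [set x | `|x - o| < r])
   ((fun s : R => chart_inv c (o + s *: (x - o))) @` `[0, 1]).
  apply/seteqP; split=> [g [gd gr]|g [x /= xr] [s /= s01 <-]].
    exists (chart_map c g) => //; exists 1; first by rewrite /= in_itv /= lexx ler01.
    by rewrite scale1r addrC subrK chart_mapK.
  have h : `|o + s *: (x - o) - o| < r.
    rewrite addrAC subrr add0r normrZ; apply: le_lt_trans xr.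
    move: s01; rewrite in_itv /= => /andP[s0 s1].
    by rewrite ger0_norm// ler_piMl.
  have h' := radm (ltW h).
  by split; [exact: chart_invP|rewrite chart_invK].
apply: bigcup_connected.
  exists 1%g => x /= xr; exists 0; first by rewrite /= in_itv /= lexx ler01.
  by rewrite scale0r addr0 chart1_invo.
move=> x /= xr; apply: connected_continuous_connected; first exact: segment_connected.
apply/continuous_in_subspaceT => s; rewrite inE /= in_itv /= => /andP[s0 s1].
apply: (@cvg_comp _ _ _ (fun s : R => o + s *: (x - o)) (chart_inv c)
  (nbhs s) (nbhs (o + s *: (x - o)))).
  exact: (cvgD (cvg_cst o) (cvgZr_tmp (@cvg_id _ (nbhs s)))).
apply: chart_inv_continuous; apply: radm.
rewrite addrAC subrr add0r normrZ; apply: le_trans (ltW xr).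
by rewrite ger0_norm// ler_piMl.
Qed.

End admissible.

Lemma nbhs_contains_cball (W : set G) : nbhs (1%g : G) W ->
  \forall r \near 0^'+, coord_cball r `<=` W.
Proof.
move=> W1; have : nbhs o (chart_inv c @^-1` W).
  by apply: chart_inv_continuous; [exact: chart1_codo|rewrite /= chart1_invo].
move=> /nbhs_ballP[e /= e0 be]; near=> r => g [gd gr].
rewrite -(chart_mapK gd); apply: be; rewrite -ball_normE /= distrC.
by apply: (le_lt_trans gr); near: r; exact: nbhs_right_lt.
Unshelve. all: by end_near. Qed.

Lemma one_param0 (gamma : R -> G) :
  (forall s t, gamma (s + t) = (gamma s * gamma t)%g) -> gamma 0 = 1%g.
Proof. by move=> gD; apply: (@mulgI _ (gamma 0)); rewrite mulg1 -gD addr0. Qed.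

Lemma one_paramN (gamma : R -> G) :
  (forall s t, gamma (s + t) = (gamma s * gamma t)%g) ->
  forall t, gamma (- t) = (gamma t)^-1%g.
Proof.
by move=> gD t; apply: (@mulgI _ (gamma t)); rewrite -gD subrr one_param0// mulgV.
Qed.

End topological_group.

(** * Powers of small elements and Lipschitz families of homomorphisms *)

Section local_group.
Context {R : realType} {n : nat} (G : lieGroupType R n).
Local Notation E := 'rV[R]_n.
Local Notation c := (chart1 G).
Local Notation o := (origin G).
Local Notation m := (fun p : E * E => local_mul G p.1 p.2).
Local Notation S := [set xy : E * E | [/\ chart_cod (chart1 G) xy.1, chart_cod (chart1 G) xy.2
  & chart_dom (chart1 G) (chart_inv (chart1 G) xy.1 * chart_inv (chart1 G) xy.2)%g]].

Lemma local_mulE g h : chart_dom c g -> chart_dom c h ->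
  local_mul G (chart_map c g) (chart_map c h) = chart_map c (g * h)%g.
Proof. by move=> gd hd; rewrite /local_mul !chart_mapK. Qed.

Lemma local_mul_o x : chart_cod c x -> local_mul G x o = x.
Proof. by move=> xc; rewrite /local_mul chart1_invo mulg1 chart_invK. Qed.

Lemma local_o_mul x : chart_cod c x -> local_mul G o x = x.
Proof. by move=> xc; rewrite /local_mul chart1_invo mul1g chart_invK. Qed.

Lemma local_mul_differentiable p : S p -> differentiable m p.
Proof. by have [+ _] := local_mul_smooth G 1; exact. Qed.

Lemma local_mul_differentiable2 v p : S p -> differentiable ('D_v m) p.
Proof. by have [_ /(_ v)[+ _]] := local_mul_smooth G 2; exact. Qed.

Lemma chart_map1 : chart_map c 1%g = o. Proof. by []. Qed.

Lemma nbhs_cod : nbhs o (chart_cod c).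
Proof. by apply: open_nbhs_nbhs; split; [exact: chart_cod_open|exact: chart1_codo]. Qed.

Lemma domain_xo x : chart_cod c x -> S (x, o).
Proof.
by move=> xc; split=> //=; [exact: chart1_codo|rewrite chart1_invo mulg1; exact: chart_invP].
Qed.

Lemma domain_ox x : chart_cod c x -> S (o, x).
Proof.
by move=> xc; split=> //=; [exact: chart1_codo|rewrite chart1_invo mul1g; exact: chart_invP].
Qed.

Lemma derive_local_mul_right v : 'D_((0 : E), v) m (o, o) = v.
Proof.
rewrite -(@derive_pair2 _ _ m v o o) -[RHS](derive_id o v); apply: near_eq_derive.
by apply: filterS nbhs_cod => x; exact: local_o_mul.
Qed.

Lemma derive_local_mul_left v : 'D_(v, (0 : E)) m (o, o) = v.
Proof.
rewrite -(@derive_pair1 _ _ m v o o) -[RHS](derive_id o v); apply: near_eq_derive.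
by apply: filterS nbhs_cod => x; exact: local_mul_o.
Qed.

Let near_right_derivative : \forall p \near ((o, o) : E * E), S p /\
  forall h, `|'D_((0 : E), h) m p - h| <= 2^-1 * `|h|.
Proof.
pose e : R := (2 * n.+1%:R)^-1.
have e0 : 0 < e by rewrite invr_gt0 mulr_gt0.
have nS := local_mul_dom_nbhs G.
have coord (i : 'I_n) : \forall p \near ((o, o) : E * E),
    `|'D_((0 : E), delta_mx ord0 i) m p - delta_mx ord0 i| <= e.
  have d2 : differentiable ('D_((0 : E), delta_mx ord0 i) m) (o, o).
    by apply: local_mul_differentiable2; exact: domain_xo chart1_codo.
  have cv : 'D_((0 : E), delta_mx ord0 i) m p @[p --> ((o, o) : E * E)] -->
      'D_((0 : E), delta_mx ord0 i) m (o, o) := differentiable_continuous d2.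
  rewrite derive_local_mul_right in cv.
  move/cvgrPdist_le : cv => /(_ _ e0).
  by apply: (@filterS _ _ (nbhs_filter _)) => p; rewrite distrC.
have coords := @filter_forall _ _ _ _ (nbhs_filter _) coord.
apply: (@filterS2 _ _ (nbhs_filter _) _ _ _ _ nS coords) => p Sp cp; split=> // h.
have dm := local_mul_differentiable Sp.
have -> : 'D_((0 : E), h) m p - h = \sum_i h ord0 i *:
    ('D_((0 : E), delta_mx ord0 i) m p - delta_mx ord0 i).
  under eq_bigr do rewrite scalerBr; rewrite sumrB -row_sum_delta; congr (_ - _).
  rewrite deriveE//.
  have -> : ((0 : E), h) = \sum_i h ord0 i *: ((0 : E), delta_mx ord0 i) :> E * E.
    rewrite [h in LHS]row_sum_delta; elim/big_rec2 : _ => // i _ y _ <-.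
    by congr pair; rewrite /= scaler0 add0r.
  rewrite linear_sum; apply: eq_bigr => i _.
  by rewrite linearZ deriveE.
apply: (le_trans (ler_norm_sum _ _ _)).
apply: (@le_trans _ _ (\sum_(i < n) `|h| * e)).
  by apply: ler_sum => i _; rewrite normrZ ler_pM// coord_norm_le.
rewrite sumr_const card_ord -[leLHS]mulr_natr -mulrA mulrC ler_wpM2r//.
rewrite /e invfM -mulrA ger_pMr ?invr_gt0//.
by rewrite ler_pdivrMl ?ltr0n// mulr1 ler_nat.
Qed.

(** The derivative of the multiplication in its second argument is close to the
identity near (o, o), so the mean value inequality compares multiplication by y
on the right with translation by y - o. *)
Lemma near_right_increment : \forall r \near (0 : R)^'+, forall x y : E,
  `|x - o| <= r -> `|y - o| <= r ->
  S (x, y) /\ `|local_mul G x y - x - (y - o)| <= 2^-1 * `|y - o|.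
Proof.
have /nbhs_ballP[e /= e0 be] := near_right_derivative.
near=> r => x y xr yr.
have re : r < e by near: r; exact: nbhs_right_lt.
have inb z w : `|z - o| <= r -> `|w - o| <= r -> ball ((o, o) : E * E) e (z, w).
  by move=> zr wr; split; rewrite /= -ball_normE /= distrC; exact: le_lt_trans re.
have [Sxy _] := be _ (inb _ _ xr yr); split=> //.
pose phi := fun t : R => m ((x, o) + t *: ((0 : E), y - o)) - id (0 + t *: (y - o)).
have ptE (t : R) : (x, o) + t *: ((0 : E), y - o) = (x, o + t *: (y - o)) :> E * E.
  by congr pair; rewrite /= scaler0 addr0.
have inS (t : R) : 0 <= t <= 1 -> ball ((o, o) : E * E) e ((x, o) + t *: ((0 : E), y - o)).
  move=> /andP[t0 t1]; rewrite ptE; apply: inb => //.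
  rewrite addrAC subrr add0r normrZ ger0_norm//; apply: le_trans yr.
  by rewrite ler_piMl.
pose dphi := fun t : R => 'D_((0 : E), y - o) m ((x, o) + t *: ((0 : E), y - o)) - (y - o).
have dphiP (t : R) : 0 <= t <= 1 -> is_derive t (1 : R) phi (dphi t).
  move=> t01; have [St _] := be _ (inS _ t01).
  have -> : dphi t = 'D_((0 : E), y - o) m ((x, o) + t *: ((0 : E), y - o)) -
      'D_(y - o) id (0 + t *: (y - o)) by rewrite derive_id.
  apply: is_deriveB; last by apply: is_derive_line; exact: ex_diff.
  by apply: is_derive_line; exact: local_mul_differentiable.
have -> : local_mul G x y - x - (y - o) = phi 1 - phi 0.
  have xc : chart_cod c x by case: Sxy.
  rewrite /phi !ptE !scale0r !addr0 !scale1r !add0r /= subr0 local_mul_o//.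
  by rewrite addrCA subrr addr0 addrAC.
apply: mean_value_le => t t01; first by have /@ex_derive := dphiP t t01.
have -> : 'D_1 phi t = dphi t by have /@derive_val := dphiP t t01.
by have [_] := be _ (inS _ t01); exact.
Unshelve. all: by end_near. Qed.

Section powers.
Variable r : R.
Hypothesis increment : forall x y : E, `|x - o| <= r -> `|y - o| <= r ->
  S (x, y) /\ `|local_mul G x y - x - (y - o)| <= 2^-1 * `|y - o|.

Let mulP g h : coord_cball r g -> coord_cball r h -> chart_dom c (g * h)%g /\
  `|chart_map c (g * h)%g - chart_map c g - (chart_map c h - o)| <=
     2^-1 * `|chart_map c h - o|.
Proof.
move=> [gd gr] [hd hr]; have [[_ _ dgh] est] := increment gr hr; split.
  by move: dgh; rewrite /= !chart_mapK.
by rewrite -local_mulE.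
Qed.

Lemma power_small (g : G) k : chart_dom c g ->
  3 / 2 * k%:R * `|chart_map c g - o| <= r ->
  chart_dom c (g ^+ k)%g /\
  `|chart_map c (g ^+ k)%g - o| <= 3 / 2 * k%:R * `|chart_map c g - o|.
Proof.
move=> gd; set a := `|chart_map c g - o|; have a0 : 0 <= a by exact: normr_ge0.
elim: k => [_|k IH].
  by split; [exact: chart1_dom1|rewrite expg0 -/o subrr normr0 mulr0 mul0r].
rewrite -natr1 => kr; have ka0 : 0 <= k%:R * a by rewrite mulr_ge0.
have [|dk bk] := IH; first by move: kr; lra.
have gr : coord_cball r g by split=> //; rewrite -/a; lra.
have gkr : coord_cball r (g ^+ k)%g by split=> //; apply: (le_trans bk); lra.
have [dS est] := mulP gkr gr.
rewrite expgSr; split=> //; set z := chart_map c (_ * _)%g in est *.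
have -> : z - o = (z - chart_map c (g ^+ k)%g - (chart_map c g - o)) +
    ((chart_map c (g ^+ k)%g - o) + (chart_map c g - o)).
  by rewrite [X in _ = _ + X]addrC addrA subrK addrA subrK.
have h1 := ler_normD (z - chart_map c (g ^+ k)%g - (chart_map c g - o))
    ((chart_map c (g ^+ k)%g - o) + (chart_map c g - o)).
have h2 := ler_normD (chart_map c (g ^+ k)%g - o) (chart_map c g - o).
apply: (le_trans h1); rewrite -/a in est h2 *; lra.
Qed.

(** By the increment estimate each multiplication by g adds the same displacement up
to half of its size, as long as the powers stay small; these errors add up. *)
Lemma power_displacement (g : G) N : coord_cball r g ->
  (forall k, (k <= N)%N -> coord_cball r (g ^+ k)%g) ->
  `|chart_map c (g ^+ N)%g - o - N%:R *: (chart_map c g - o)| <=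
    N%:R * (2^-1 * `|chart_map c g - o|).
Proof.
move=> gr; elim: N => [_|N IH pw].
  by rewrite expg0 chart_map1 mulr0n scale0r mul0r subrr subr0 normr0.
have {}IH := IH (fun k kN => pw k (leqW kN)).
have [_ est] := mulP (pw N (leqnSn N)) gr; rewrite expgSr.
set z := chart_map c (_ * _)%g in est *; set y := chart_map c (g ^+ N)%g in est IH.
set u := chart_map c g - o in est IH *.
have -> : z - o - N.+1%:R *: u = (z - y - u) + (y - o - N%:R *: u).
  rewrite -natr1 scalerDl scale1r opprD (addrAC z (- y)) -(addrA y) [RHS]addrA.
  by rewrite subrK [RHS]addrACA (addrC (- u)).
by rewrite (le_trans (ler_normD _ _))// -natr1 mulrDl mul1r addrC lerD.
Qed.

Lemma power_bounded_small (g : G) N : (0 < N)%N ->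
  (forall k, (k <= N)%N -> coord_cball r (g ^+ k)%g) ->
  `|chart_map c g - o| <= 2 * r / N%:R.
Proof.
move=> N0 pw; have gr : coord_cball r g by have := pw 1%N N0; rewrite expg1.
have h := power_displacement gr pw; have [_ h'] := pw N (leqnn N).
have NR : 0 < N%:R :> R by rewrite ltr0n.
rewrite ler_pdivlMr//; move: h; set u := chart_map c g - o; set y := chart_map c _ - o => h.
have : `|N%:R *: u| <= r + N%:R * (2^-1 * `|u|).
  have -> : N%:R *: u = y - (y - N%:R *: u) by rewrite opprB addrC subrK.
  by rewrite (le_trans (ler_normB _ _))// lerD.
rewrite normrZ gtr0_norm// => h2; rewrite mulrC; move: h2; set w := `|u|; lra.
Qed.
End powers.

Section lipschitz.
Variables (I : Type) (cj : I -> G -> G).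
Hypothesis cjM : forall i g h, cj i (g * h)%g = (cj i g * cj i h)%g.
Hypothesis cj_equi : forall W, nbhs (1%g : G) W ->
  \forall f \near (1%g : G), forall i, W (cj i f).

(** For f at distance a from the identity about eta / a powers of f remain in the
eta-ball.  Their images, the powers of cj i f, remain in the r-ball, so cj i f is
at distance at most 2 r divided by the number of these powers. *)
Lemma equicontinuous_lipschitz : exists C : R, \forall f \near (1%g : G),
  forall i, chart_dom c (cj i f) /\
    `|chart_map c (cj i f) - o| <= C * `|chart_map c f - o|.
Proof.
have cj1 i : cj i 1%g = 1%g.
  by apply: (@mulgI _ (cj i 1%g)); rewrite -cjM !mulg1.
have cjX i g k : cj i (g ^+ k)%g = (cj i g ^+ k)%g.
  by elim: k => [|k IH]; rewrite ?expg0 ?cj1// !expgS cjM IH.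
near (0 : R)^'+ => r.
have r0 : 0 < r by near: r; exact: nbhs_right_gt.
have inc : forall x y : E, `|x - o| <= r -> `|y - o| <= r ->
    S (x, y) /\ `|local_mul G x y - x - (y - o)| <= 2^-1 * `|y - o|.
  by near: r; exact: near_right_increment.
have cball1 : nbhs (1%g : G) (coord_cball r).
  by move/(@nbhs_coord_ball R n G) : r0; apply: filterS => g [gd /ltW gr].
have eqr := cj_equi cball1.
near (0 : R)^'+ => eta.
have eta0 : 0 < eta by near: eta; exact: nbhs_right_gt.
have eta_r : eta <= r by near: eta; exact: nbhs_right_le.
have eqeta : coord_cball eta `<=` [set f : G | forall i, coord_cball r (cj i f)].
  by near: eta; exact: nbhs_contains_cball.
exists (6 * r / eta).
have e30 : 0 < eta / 3 by rewrite divr_gt0.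
move/(@nbhs_coord_ball R n G) : e30; apply: filterS => f [fd fr] i.
have fcb : coord_cball eta f by split=> //; move: fr; lra.
have [cd cr] := eqeta f fcb i; split=> //.
have [f0|f_neq0] := eqVneq (chart_map c f) o.
  have -> : f = 1%g by rewrite -(chart_mapK fd) f0 chart1_invo.
  by rewrite cj1 chart_map1 subrr normr0 mulr0.
set a := `|chart_map c f - o| in fr *.
have a0 : 0 < a by rewrite normr_gt0 subr_eq0.
(* At least q / 2 powers of f stay in the eta-ball. *)
pose q : R := eta / (3 / 2 * a); pose N : nat := Num.trunc q.
have q2 : 2 <= q by rewrite ler_pdivlMr ?mulr_gt0//; move: fr; lra.
have q0 : 0 <= q by lra.
have Nq : N%:R <= q by rewrite truncn_le.
have qN : q < N%:R + 1 by rewrite natr1 truncnS_gt.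
have N0 : (0 < N)%N by rewrite -(ltr_nat R); lra.
have pw k : (k <= N)%N -> coord_cball r (cj i f ^+ k)%g.
  move=> kN; rewrite -cjX; apply: (eqeta (f ^+ k)%g).
  have kq : 3 / 2 * k%:R * a <= eta.
    have : k%:R <= q by apply: le_trans Nq; rewrite ler_nat.
    by rewrite /q ler_pdivlMr ?mulr_gt0//; lra.
  have [pd pb] := power_small inc fd (le_trans kq eta_r).
  by split=> //; exact: le_trans kq.
have := power_bounded_small inc N0 pw.
move/le_trans; apply.
have NR : 0 < N%:R :> R by rewrite ltr0n.
rewrite ler_pdivrMr//.
have e : eta = q * (3 / 2 * a) by rewrite /q divfK// mulf_neq0// gt_eqF.
have -> : 6 * r / eta * a * N%:R = 4 * r * (N%:R / q).
  rewrite /q; field; rewrite !gt_eqF//.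
rewrite -[leLHS]mulr1; have : 1 / 2 <= N%:R / q by rewrite ler_pdivlMr; lra.
move=> h; have -> : 2 * r * 1 = 4 * r * (1 / 2) by lra.
by rewrite ler_pM2l// mulr_gt0.
Unshelve. all: by end_near. Qed.

End lipschitz.
End local_group.

(** * Conjugation by a one-parameter subgroup, in the chart *)

Section conjugation.
Context {R : realType} {n : nat} (G : lieGroupType R n).
Local Notation E := 'rV[R]_n.
Local Notation c := (chart1 G).
Local Notation o := (origin G).
Local Notation m := (fun p : E * E => local_mul G p.1 p.2).
Local Notation S := [set xy : E * E | [/\ chart_cod (chart1 G) xy.1, chart_cod (chart1 G) xy.2
  & chart_dom (chart1 G) (chart_inv (chart1 G) xy.1 * chart_inv (chart1 G) xy.2)%g]].
Variables (d : E) (gamma : R -> G) (C : R).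
Hypothesis gamma_continuous : continuous gamma.
Hypothesis gammaD : forall s t, gamma (s + t) = (gamma s * gamma t)%g.
Let curve : R -> E := fun s => chart_map c (gamma s).
Hypothesis gamma_derivative : is_derive (0 : R) (1 : R) curve d.
Let cj (t : R) (f : G) : G := (gamma t * f * gamma (- t))%g.
Hypothesis cj_lipschitz : \forall f \near (1%g : G), forall t,
  chart_dom c (cj t f) /\ `|chart_map c (cj t f) - o| <= C * `|chart_map c f - o|.

Let gamma0 : gamma 0 = 1%g. Proof. exact: one_param0. Qed.

Let curve0 : curve 0 = o. Proof. by rewrite /curve gamma0. Qed.

Let gammaNr t : (gamma t * gamma (- t))%g = 1%g.
Proof. by rewrite -gammaD subrr. Qed.

Let cjD s t f : cj (s + t) f = cj s (cj t f).
Proof. by rewrite /cj gammaD opprD addrC gammaD !mulgA. Qed.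

Let cj0 f : cj 0 f = f. Proof. by rewrite /cj oppr0 gamma0 mulg1 mul1g. Qed.

(** Conjugation by gamma s, read in the chart, for s near 0 and x near o.  Written
with local multiplications it is differentiable by the chain rule. *)
Definition local_conj (s : R) (x : E) : E :=
  local_mul G (local_mul G (curve s) x) (curve (- s)).
Local Notation F := local_conj.

Let near_dom : \forall s \near (0 : R), chart_dom c (gamma s) /\ chart_dom c (gamma (- s)).
Proof.
have nd : nbhs (1%g : G) (chart_dom c).
  by apply: open_nbhs_nbhs; split; [exact: chart_dom_open|exact: chart1_dom1].
have c1 : gamma s @[s --> (0 : R)] --> (1%g : G) by rewrite -gamma0; exact: gamma_continuous.
have c2 : gamma (- s) @[s --> (0 : R)] --> (1%g : G).
  apply: (@cvg_comp _ _ _ (fun t : R => - t) gamma (nbhs (0 : R)) (nbhs (0 : R))); last exact: c1.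
  have cN : - t @[t --> (0 : R)] --> - (0 : R) by apply: cvgN; exact: cvg_id.
  by rewrite oppr0 in cN.
by apply: filterI; [exact: c1|exact: c2].
Qed.

Let local_conj_o s : chart_dom c (gamma s) -> chart_dom c (gamma (- s)) -> F s o = o.
Proof.
move=> ds ds'; rewrite /F local_mul_o ?local_mulE ?gammaNr//.
exact: chart_mapP.
Qed.

Let local_conj_differentiable s :
  chart_dom c (gamma s) -> chart_dom c (gamma (- s)) -> differentiable (F s) o.
Proof.
move=> ds ds'; have sc : chart_cod c (curve s) by exact: chart_mapP.
have d1 : differentiable (local_mul G (curve s)) o.
  apply: (@differentiable_comp _ _ _ _ (fun x : E => (curve s, x)) m).
    by apply: differentiable_pair; [exact: differentiable_cst|exact: ex_diff].
  by apply: local_mul_differentiable; exact: domain_xo.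
apply: (@differentiable_comp _ _ _ _ (fun x : E => (local_mul G (curve s) x, curve (- s))) m).
  by apply: differentiable_pair => //; exact: differentiable_cst.
apply: local_mul_differentiable => /=; rewrite local_mul_o//; split=> //=.
  exact: chart_mapP.
by rewrite !chart_mapK// gammaNr; exact: chart1_dom1.
Qed.

Let near_local_conjE : \forall s \near (0 : R) & x \near o,
  chart_cod c x /\ F s x = chart_map c (cj s (chart_inv c x)).
Proof.
have nd : nbhs (1%g : G) (chart_dom c).
  by apply: open_nbhs_nbhs; split; [exact: chart_dom_open|exact: chart1_dom1].
have cv : (gamma p.1 * chart_inv c p.2)%g @[p --> ((0, o) : R * E)] --> (1 * 1 : G)%g.
  apply: cvg_mulg.
    rewrite -gamma0; apply: (@cvg_comp _ _ _ fst gamma _ (nbhs (0 : R))).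
      exact: cvg_fst.
    exact: gamma_continuous.
  rewrite -chart1_invo; apply: (@cvg_comp _ _ _ snd (chart_inv c) _ (nbhs o)).
    exact: cvg_snd.
  by apply: chart_inv_continuous; exact: chart1_codo.
rewrite mulg1 in cv; have nc := @nbhs_cod R n G; have gdom := cv _ nd.
have n1 : \forall p \near ((0, o) : R * E),
    chart_dom c (gamma p.1) /\ chart_dom c (gamma (- p.1)).
  exists ([set s | chart_dom c (gamma s) /\ chart_dom c (gamma (- s))], setT).
    by split; [exact: near_dom|exact: filterT].
  by move=> [s x] [].
have n2 : \forall p \near ((0, o) : R * E), chart_cod c p.2.
  exists (setT, chart_cod c); first by split; [exact: filterT|exact: nc].
  by move=> [s x] [].
apply: (@filterS3 _ _ (nbhs_filter ((0, o) : R * E)) _ _ _ _ _ n1 n2 gdom).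
move=> -[s x] /= [ds ds'] xc dsx; split=> //.
have dx : chart_dom c (chart_inv c x) by exact: chart_invP.
have e1 : local_mul G (curve s) x = chart_map c (gamma s * chart_inv c x)%g.
  by rewrite -[in LHS](chart_invK xc) local_mulE.
by rewrite /local_conj e1 local_mulE.
Qed.

Let lipschitz_coord : \forall x \near o, chart_cod c x /\ forall t,
  chart_dom c (cj t (chart_inv c x)) /\
  `|chart_map c (cj t (chart_inv c x)) - o| <= C * `|x - o|.
Proof.
have cv : chart_inv c x @[x --> o] --> (1%g : G).
  by rewrite -chart1_invo; apply: chart_inv_continuous; exact: chart1_codo.
have near1 := cv _ cj_lipschitz; have nc := @nbhs_cod R n G.
near=> x; have xc : chart_cod c x by near: x; exact: nc.
split=> // t.
have : forall t, chart_dom c (cj t (chart_inv c x)) /\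
    `|chart_map c (cj t (chart_inv c x)) - o| <= C * `|chart_map c (chart_inv c x) - o|.
  by near: x; exact: near1.
by move=> /(_ t)[cd]; rewrite chart_invK.
Unshelve. all: by end_near. Qed.

(** Iterating conjugation by gamma s amounts to conjugating by gamma (s *+ k), to
which the Lipschitz bound applies; it also keeps the iterates where local_conj s
is conjugation. *)
Let near_iter : \forall s \near (0 : R), \forall x \near o, forall k,
  `|iter k (F s) x - o| <= C * `|x - o|.
Proof.
have [[A B] /= [A0 Bo] AB] := near_local_conjE.
have /nbhs_ballP[e /= e0 Be] := Bo.
apply: (@filterS _ _ (nbhs_filter _) _ _ _ A0) => s As.
have e'0 : 0 < e / (`|C| + 1) by rewrite divr_gt0// ltr_wpDl.
apply: (@filterS2 _ _ (nbhs_filter _) _ _ _ _ lipschitz_coord (nbhsx_ballx o _ e'0)).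
move=> x [xc lx] xe k.
suff -> : iter k (F s) x = chart_map c (cj (s *+ k) (chart_inv c x)) by have [] := lx (s *+ k).
elim: k => [|k IH]; first by rewrite mulr0n cj0 chart_invK.
have [dk bk] := lx (s *+ k).
rewrite iterS IH.
have [|_ ->] := AB (s, chart_map c (cj (s *+ k) (chart_inv c x))).
  split=> //=; apply: Be; rewrite -ball_normE /= distrC; apply: le_lt_trans bk _.
  move: xe; rewrite -ball_normE /= distrC ltr_pdivlMr ?ltr_wpDl// => xe.
  apply: le_lt_trans xe; rewrite mulrC ler_wpM2l//.
  by rewrite (le_trans (ler_norm _))// lerDl.
by rewrite chart_mapK// mulrS cjD.
Qed.

Let Ad (s : R) : {linear E -> E} := 'd (F s) o.

Let Ad_power_bounded : \forall s \near (0 : R), forall k v, `|iter k (Ad s) v| <= C * `|v|.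
Proof.
near=> s => k v.
have [ds ds'] : chart_dom c (gamma s) /\ chart_dom c (gamma (- s)).
  by near: s; exact: near_dom.
have df := local_conj_differentiable ds ds'.
have [dk <-] := diff_iter (local_conj_o ds ds') df k.
have it : \forall x \near o, forall k, `|iter k (F s) x - o| <= C * `|x - o|.
  by near: s; exact: near_iter.
apply: diff_norm_le => //.
have -> : iter k (F s) o = o by elim: (k) => //= j ->; exact: local_conj_o.
by apply: filterS it => x; exact.
Unshelve. all: by end_near. Qed.

(** The identity (a f a^-1) a = a f for a = gamma s, differentiated at f = 1: it
expresses Ad s
through derivatives of left and right translations only. *)
Let Ad_intertwines : \forall s \near (0 : R), forall v,
  'D_(Ad s v, (0 : E)) m (o, curve s) = 'D_((0 : E), v) m (curve s, o).
Proof.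
have [[A B] /= [A0 Bo] AB] := near_local_conjE.
apply: (@filterS2 _ _ (nbhs_filter _) _ _ _ _ A0 near_dom) => s As [ds ds'] v.
have sc : chart_cod c (curve s) by exact: chart_mapP.
have Fo := local_conj_o ds ds'.
pose h := fun y : E => m (y, curve s).
have dh : differentiable h (F s o).
  rewrite Fo; apply: (@differentiable_comp _ _ _ _ (fun x : E => (x, curve s)) m).
    by apply: differentiable_pair; [exact: ex_diff|exact: differentiable_cst].
  by apply: local_mul_differentiable; exact: domain_ox.
have dF := local_conj_differentiable ds ds'.
rewrite -derive_pair1 -derive_pair2.
have -> : 'D_(Ad s v) h o = 'D_v (h \o F s) o.
  have dc : differentiable (h \o F s) o := differentiable_comp dF dh.
  have e : 'd (h \o F s) o v = 'd h (F s o) (Ad s v).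
    exact: (congr1 (fun g : E -> E => g v) (diff_comp dF dh)).
  apply: etrans (esym (deriveE v dc)); apply: etrans (esym e).
  apply: etrans (deriveE (Ad s v) dh).
  by rewrite Fo.
apply: near_eq_derive.
apply: (@filterS2 _ _ (nbhs_filter _) _ _ _ _ lipschitz_coord Bo) => x [xc /(_ s)[cd _]] Bx.
have [_ Fx] := AB (s, x) (conj As Bx).
have dx : chart_dom c (chart_inv c x) by exact: chart_invP.
rewrite /h /= Fx /curve local_mulE// -[in RHS](chart_invK xc) local_mulE// /cj.
by rewrite (one_paramN gammaD) mulgVK.
Qed.

Let left_field_differentiable v : differentiable (left_field G v) o.
Proof.
rewrite left_fieldE; apply: (@differentiable_comp _ _ _ _ (fun x : E => (x, o)) ('D_((0 : E), v) m)).
  by apply: differentiable_pair; [exact: ex_diff|exact: differentiable_cst].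
by apply: local_mul_differentiable2; exact: domain_xo chart1_codo.
Qed.

Let left_field_o v : left_field G v o = v.
Proof. by rewrite left_fieldE; exact: derive_local_mul_right. Qed.

Let right_field (v x : E) : E := 'D_(v, (0 : E)) m (o, x).

Let right_field_differentiable v : differentiable (right_field v) o.
Proof.
apply: (@differentiable_comp _ _ _ _ (fun x : E => (o, x)) ('D_(v, (0 : E)) m)).
  by apply: differentiable_pair; [exact: differentiable_cst|exact: ex_diff].
by apply: local_mul_differentiable2; exact: domain_xo chart1_codo.
Qed.

(** This is where second derivatives of the multiplication are exchanged: the
bracket differentiates left-invariant fields, whereas Ad_intertwines brings in
right-invariant ones. *)
Let derive_right_field v : 'D_d (right_field v) o = 'D_v (left_field G d) o.
Proof.
rewrite /right_field (@derive_pair2 _ _ ('D_(v, (0 : E)) m)) derive_fieldE.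
have So : S (o, o) := domain_xo chart1_codo.
apply: derive_symmetric; [|exact: local_mul_differentiable2..].
by apply: filterS (local_mul_dom_nbhs G) => p; exact: local_mul_differentiable.
Qed.

Let row_expansion (v : E) : v = \sum_i v ord0 i *: delta_mx ord0 i.
Proof. exact: row_sum_delta. Qed.

Let pair_expansion (v : E) :
  (v, (0 : E)) = \sum_i v ord0 i *: ((delta_mx ord0 i : E), (0 : E)).
Proof.
rewrite {1}(row_expansion v); elim/big_rec2 : _ => // i _ y _ <-.
by congr pair; rewrite /= scaler0 add0r.
Qed.

(** Ad_intertwines, solved for Ad s v - v; the coordinates of Ad s v are left on
the right-hand side, where they multiply a factor tending to 0. *)
Let near_Ad_expansion v : \forall s \near (0 : R), Ad s v - v =
  (left_field G v (curve s) - v) -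
  \sum_i Ad s v ord0 i *: (right_field (delta_mx ord0 i) (curve s) - delta_mx ord0 i).
Proof.
apply: (@filterS2 _ _ (nbhs_filter _) _ _ _ _ Ad_intertwines near_dom) => s As [ds ds'].
have sc : chart_cod c (curve s) by exact: chart_mapP.
have dm : differentiable m (o, curve s) by apply: local_mul_differentiable; exact: domain_ox.
have -> : left_field G v (curve s) =
    \sum_i Ad s v ord0 i *: right_field (delta_mx ord0 i) (curve s).
  rewrite left_fieldE -As deriveE// {1}pair_expansion linear_sum.
  by apply: eq_bigr => i _; rewrite linearZ /right_field deriveE.
have -> : \sum_i Ad s v ord0 i *:
      (right_field (delta_mx ord0 i) (curve s) - delta_mx ord0 i) =
    \sum_i Ad s v ord0 i *: right_field (delta_mx ord0 i) (curve s) - Ad s v.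
  by under eq_bigr do rewrite scalerBr; rewrite sumrB -row_expansion.
by rewrite opprB [RHS]addrC addrA subrK.
Qed.

Let cvg_bounded_scale (V : normedModType R) (f : R -> R) (g : R -> V) (M : R) :
  (\forall s \near (0 : R)^', `|f s| <= M) -> g s @[s --> (0 : R)^'] --> (0 : V) ->
  f s *: g s @[s --> (0 : R)^'] --> (0 : V).
Proof.
move=> bf /cvgrPdist_le cg; apply/cvgrPdist_le => e e0.
have M1 : 0 < `|M| + 1 by rewrite ltr_wpDl.
have e'0 : 0 < e / (`|M| + 1) by rewrite divr_gt0.
move: (cg _ e'0); apply: filterS2 bf => s fs gs.
rewrite sub0r normrN normrZ; rewrite sub0r normrN in gs.
apply: (@le_trans _ _ ((`|M| + 1) * (e / (`|M| + 1)))).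
  by rewrite ler_pM// (le_trans fs)// (le_trans (ler_norm _))// lerDl.
by rewrite mulrC divfK// gt_eqF.
Qed.

Let Ad_derivative v : s^-1 *: (Ad s v - v) @[s --> (0 : R)^'] --> ad G d v.
Proof.
have cL : s^-1 *: (left_field G v (curve s) - v) @[s --> (0 : R)^'] -->
    'D_d (left_field G v) o.
  have := @cvg_curve R E E (left_field G v) curve d gamma_derivative.
  by rewrite curve0 left_field_o; apply.
have cR (i : 'I_n) : s^-1 *: (right_field (delta_mx ord0 i) (curve s) - delta_mx ord0 i)
    @[s --> (0 : R)^'] --> 'D_(delta_mx ord0 i) (left_field G d) o.
  have := @cvg_curve R E E (right_field (delta_mx ord0 i)) curve d gamma_derivative.
  rewrite curve0 derive_right_field [right_field _ o]derive_local_mul_left; apply.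
  exact: right_field_differentiable.
have p0 := @cvg_id _ ((0 : R)^').
have shrink (V : normedModType R) (f : R -> V) (l : V) :
    s^-1 *: f s @[s --> (0 : R)^'] --> l -> f s @[s --> (0 : R)^'] --> (0 : V).
  move=> cf; have cs : s *: (s^-1 *: f s) @[s --> (0 : R)^'] --> 0 *: l.
    by apply: cvgZ => //; apply: cvg_within_filter; exact: cvg_id.
  rewrite scale0r in cs; apply: cvg_trans cs; apply: near_eq_cvg.
  near=> s; rewrite scalerA divff ?scale1r//.
  by near: s; exact: nbhs_dnbhs_neq.
have bounded_coord : \forall s \near (0 : R), forall i, `|Ad s v ord0 i| <= C * `|v|.
  apply: filterS Ad_power_bounded => s bs i; apply: le_trans (bs 1%N v) => /=.
  exact: coord_norm_le.
have cA : Ad s v @[s --> (0 : R)^'] --> v.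
  have cv : v + ((left_field G v (curve s) - v) - \sum_i Ad s v ord0 i *:
      (right_field (delta_mx ord0 i) (curve s) - delta_mx ord0 i))
      @[s --> (0 : R)^'] --> v + (0 - \sum_(i < n) 0).
    apply: cvgD; first exact: cvg_cst.
    apply: cvgB; first exact: shrink cL.
    apply: cvg_big => [|i _]; first exact: add_continuous.
    apply: (@cvg_bounded_scale _ _ _ (C * `|v|)); last exact: shrink (cR i).
    by apply: cvg_within; apply: filterS bounded_coord => s; exact.
  rewrite big1// subr0 addr0 in cv; apply: cvg_trans cv; apply: near_eq_cvg.
  apply: cvg_within; apply: filterS (near_Ad_expansion v) => s e.
  by rewrite -[X in v + X]e addrC subrK.
have -> : ad G d v = 'D_d (left_field G v) o -
    \sum_i v ord0 i *: 'D_(delta_mx ord0 i) (left_field G d) o.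
  rewrite /ad /lie_bracket; congr (_ - _).
  have dl := left_field_differentiable d.
  rewrite deriveE// {1}(row_expansion v) linear_sum; apply: eq_bigr => i _.
  by rewrite linearZ deriveE.
apply: (@cvg_trans _ ((s^-1 *: (left_field G v (curve s) - v) -
   \sum_i Ad s v ord0 i *: (s^-1 *: (right_field (delta_mx ord0 i) (curve s) -
      delta_mx ord0 i))) @[s --> (0 : R)^'])).
  apply: near_eq_cvg; apply: cvg_within.
  apply: filterS (near_Ad_expansion v) => s /= ->.
  rewrite [s^-1 *: (_ - \sum_i _)]scalerBr scaler_sumr; congr (_ - _); apply: eq_bigr => i _.
  by rewrite !scalerA mulrC.
apply: cvgB => //; apply: cvg_big => [|i _]; first exact: add_continuous.
apply: cvgZ (cR i).
exact: (cvg_comp _ _ cA (@coord_continuous _ _ _ ord0 i v)).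
Unshelve. all: by end_near. Qed.

Theorem elliptic_of_lipschitz : elliptic (ad G d).
Proof.
apply: (@elliptic_of_power_bounded R n (ad G d) Ad C).
- exact: Ad_derivative.
- by apply: cvg_within; exact: Ad_power_bounded.
Qed.

End conjugation.


(** * Orbits of a stabilizer *)

Section stability.
Context {R : realType} {n : nat} {G : lieGroupType R n}.
Variables (T : topologicalType) (kappa : G -> T) (K : set G).
Hypothesis hausT : hausdorff_space T.
Hypothesis kappa_continuous : continuous kappa.
Hypothesis KM : forall g h, K g -> K h -> K (g * h)%g.
Hypothesis kappa_left : forall k g, K k -> kappa (k * g)%g = kappa g.
Hypothesis kappa_right : forall g k, K k -> kappa (g * k)%g = kappa g.
Hypothesis kappa_eq1 : forall g, kappa g = kappa 1%g -> K g.

Let thickening : exists C V : set G,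
  [/\ compact C, open V, V 1%g & forall x y, V x -> V y -> C (x^-1 * y)%g].
Proof.
near (0 : R)^'+ => r.
have radm : forall x : 'rV[R]_n, `|x - origin G| <= r -> chart_cod (chart1 G) x.
  by near: r; exact: near0_cball_cod.
have Cn : nbhs (1%g : G) (@coord_cball R n G r).
  have : 0 < r by near: r; exact: nbhs_right_gt.
  by move/(@nbhs_coord_ball R n G); apply: filterS => g [gd /ltW gr].
have : nbhs ((1%g, 1%g) : G * G) [set p | coord_cball r (p.1^-1 * p.2)%g].
  have cv : (p.1^-1 * p.2)%g @[p --> ((1%g, 1%g) : G * G)] --> (1^-1 * 1 : G)%g.
    apply: cvg_mulg; last exact: cvg_snd.
    by apply: cvg_invg; exact: cvg_fst.
  by apply: cv; rewrite invg1 mulg1.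
move=> [[A B] /= [A1 B1] AB].
exists (coord_cball r), (A `&` B)°; split.
- exact: compact_coord_cball.
- exact: open_interior.
- exact: filterI.
- by move=> x y /interior_subset[Ax _] /interior_subset[_ By]; exact: (AB (x, y)).
Unshelve. all: by end_near. Qed.

(** The points of C outside V K are separated from a neighbourhood of the identity
by the values of kappa.  Inside k U the set V K is open, and its closure is in
C K, hence again in V K because kappa is K-invariant; so it is all of k U. *)
Let stable_nbhd : exists C U : set G, [/\ compact C, nbhs (1%g : G) U &
  forall k u, K k -> U u -> exists x y, [/\ C x, K y & (k * u = x * y)%g]].
Proof.
have [C [V [Cc Oo O1 OC]]] := thickening.
pose OK := [set g : G | exists x y, [/\ V x, K y & g = (x * y)%g]].
have OKo : open OK.
  rewrite openE => _ [x [y [Ox Ky ->]]].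
  have : nbhs (x * y)%g [set g : G | V (g * y^-1)%g].
    have cv : (g * y^-1)%g @[g --> (x * y)%g] --> x.
      rewrite -[X in _ --> X](mulgK y x).
      by apply: cvg_mulg; [exact: cvg_id|exact: cvg_cst].
    by apply: (cv V); exact: open_nbhs_nbhs.
  by apply: filterS => g Og; exists (g * y^-1)%g, y; split=> //; rewrite mulgVK.
have K_OK k : K k -> OK k by exists 1%g, k; split=> //; rewrite mul1g.
have Cbd : compact (C `&` ~` OK).
  apply: (subclosed_compact _ Cc); last by move=> g [].
  apply: closedI; last exact: open_closedC.
  exact: compact_closed manifold_hausdorff Cc.
have sepU : \forall u \near (1%g : G), C `&` ~` OK `<=` [set x | kappa x <> kappa u].
  move/compact_near_coveringP : Cbd; apply => x [_ nOKx].
  have neq : kappa x != kappa 1%g.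
    by apply/eqP => /kappa_eq1/K_OK.
  have := hausT; rewrite open_hausdorff => /(_ _ _ neq)[[A B]] /= [/set_mem Ax /set_mem B1] [Ao Bo /eqP AB].
  exists (kappa @^-1` A, kappa @^-1` B) => /=.
    by split; apply: kappa_continuous; exact: open_nbhs_nbhs.
  move=> [y u] /= [Ay Bu] yu; have : (A `&` B) (kappa y) by split=> //; rewrite yu.
  by rewrite AB.
near (0 : R)^'+ => r.
have radm : forall x : 'rV[R]_n, `|x - origin G| <= r -> chart_cod (chart1 G) x.
  by near: r; exact: near0_cball_cod.
have rU : coord_cball r `<=` [set u | C `&` ~` OK `<=` [set x | kappa x <> kappa u]].
  by near: r; exact: nbhs_contains_cball.
have r0 : 0 < r by near: r; exact: nbhs_right_gt.
exists C, (coord_ball r); split=> //; first exact: nbhs_coord_ball.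
move=> k u Kk Uu.
suff : [set u | coord_ball r u /\ OK (k * u)%g] = coord_ball r.
  move/seteqP => [_ /(_ _ Uu)[_ [x [y [Ox Ky ->]]]]]; exists x, y; split=> //.
  by rewrite -[x]mul1g -[1%g](invg1 G); exact: OC.
have lk : continuous (fun u : G => k * u)%g.
  by move=> v; apply: cvg_mulg; [exact: cvg_cst|exact: cvg_id].
apply: (connected_coord_ball radm).
- exists 1%g; split; last by rewrite mulg1; exact: K_OK.
  exact: nbhs_singleton (nbhs_coord_ball r0).
- exists ((fun u : G => k * u)%g @^-1` OK) => //.
  by apply: open_comp => // v _; exact: lk.
exists (closure [set u | OK (k * u)%g]); first exact: closed_closure.
apply/seteqP; split=> v [vr h]; split=> //; first exact: subset_closure.
(* Here k v lies in the closure of V K, hence in C K. *)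
have : nbhs v [set w : G | V (k * w * (k * v)^-1)%g].
  have cv : (k * w * (k * v)^-1)%g @[w --> v] --> (1 : G)%g.
    rewrite -[X in _ --> X](mulgV (k * v)%g).
    by apply: cvg_mulg; [exact: lk|exact: cvg_cst].
  by apply: (cv V); exact: open_nbhs_nbhs.
move=> /h[w [[x [y [Ox Ky kw]]] Ow]].
have kvE : (k * v)%g = ((k * w * (k * v)^-1)^-1 * x * y)%g.
  by rewrite -mulgA -kw invgM invgK mulgVK.
pose z := ((k * w * (k * v)^-1)^-1 * x)%g.
have Cz : C z by exact: OC.
have OKz : OK z.
  apply: contrapT => nOKz.
  have := rU v; case: (vr) => vd /ltW vr' /(_ (conj vd vr')) /(_ z (conj Cz nOKz)) /=.
  by rewrite -(kappa_right _ Ky) -kvE kappa_left.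
have [x' [y' [Ox' Ky' zE]]] := OKz.
by exists x', (y' * y)%g; split=> //; [exact: KM|rewrite mulgA -zE].
Unshelve. all: by end_near. Qed.

(** If k g = x y with x in a compact set and y in K, then y u is in C K for u in
the stable neighbourhood, so the property passes from g to g u. *)
Theorem orbits_relatively_compact : connected [set: G] -> forall g, exists2 C : set G,
  compact C & forall k, K k -> exists x y, [/\ C x, K y & (k * g = x * y)%g].
Proof.
move=> Gc; have [C [U [Cc U1 CU]]] := stable_nbhd.
pose good := [set g : G | exists2 C : set G,
  compact C & forall k, K k -> exists x y, [/\ C x, K y & (k * g = x * y)%g]].
have good_step g u : good g -> U u -> good (g * u)%g.
  move=> [C' C'c C'g] Uu.
  exists ((fun p : G * G => (p.1 * p.2)%g) @` (C' `*` C)).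
    apply: continuous_compact; last exact: compact_setX.
    by apply: continuous_subspaceT; exact: lie_mul_continuous.
  move=> k /C'g[x [y [C'x Ky kg]]]; have [x' [y' [Cx' Ky' yu]]] := CU _ _ Ky Uu.
  exists (x * x')%g, y'; split=> //; first by exists (x, x').
  by rewrite mulgA kg -mulgA yu mulgA.
have good1 : good 1%g.
  exists [set 1%g]; first exact: compact_set1.
  by move=> k Kk; exists 1%g, k; rewrite mulg1 mul1g; split.
suff : good = [set: G] by move=> /seteqP[_ + g]; exact.
apply: Gc; first by exists 1%g.
- exists good; last by rewrite setTI.
  rewrite openE => g gg.
  have : nbhs g [set h : G | U (g^-1 * h)%g].
    have cv : (g^-1 * h)%g @[h --> g] --> (1 : G)%g.
      rewrite -[X in _ --> X](mulVg g).
      by apply: cvg_mulg; [exact: cvg_cst|exact: cvg_id].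
    exact: (cv _ U1).
  by apply: filterS => h /(good_step _ _ gg); rewrite mulgA mulgV mul1g.
- exists good; last by rewrite setTI.
  move=> g cg.
  have : nbhs g [set h : G | U (h^-1 * g)%g].
    have cv : (h^-1 * g)%g @[h --> g] --> (1 : G)%g.
      rewrite -[X in _ --> X](mulVg g).
      by apply: cvg_mulg; [apply: cvg_invg; exact: cvg_id|exact: cvg_cst].
    exact: (cv _ U1).
  by move=> /cg[h [gh Uh]]; have := good_step _ _ gh Uh; rewrite mulgA mulgV mul1g.
Qed.

End stability.

(** * Eigenvectors in unitary representations *)

Section inner_product.
Context {R : realType} {H : completeNormedModType R[i]}.
Variable ip : {dot H for Num.conj}.
Hypothesis hilbert : hilbert_inner_product ip.
Implicit Types (u v w : H) (a : R[i]).

Lemma ipZl a u v : ip (a *: u) v = a * ip u v. Proof. exact: linearZl_LR. Qed.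
Lemma ipZr a u v : ip u (a *: v) = a^* * ip u v. Proof. exact: linearZr_LR. Qed.
Lemma ipBl u v w : ip (u - v) w = ip u w - ip v w. Proof. exact: linearBl. Qed.
Lemma ipBr u v w : ip u (v - w) = ip u v - ip u w. Proof. exact: linearBr. Qed.
Lemma ip_conj u v : ip u v = (ip v u)^*.
Proof. by rewrite hermC expr0 mul1r. Qed.

(** Pythagoras for the orthogonal projection to the line through w: it gives both
the Cauchy-Schwarz inequality and its equality case. *)
Lemma norm_sub_proj (w u : H) : w != 0 ->
  `|u - (ip u w / `|w| ^+ 2) *: w| ^+ 2 = `|u| ^+ 2 - `|ip u w| ^+ 2 / `|w| ^+ 2.
Proof.
move=> w0; set a := _ / _; have w2 : `|w| ^+ 2 != 0 by rewrite expf_neq0// normr_eq0.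
have pw : ip (u - a *: w) w = 0.
  by rewrite ipBl ipZl -hilbert divfK// subrr.
rewrite [LHS]hilbert ipBr ipZr pw mulr0 subr0 ipBl ipZl -hilbert; congr (_ - _).
by rewrite (ip_conj w) normCK mulrAC.
Qed.

Lemma ip_le u w : `|ip u w| <= `|u| * `|w|.
Proof.
have [->|w0] := eqVneq w 0.
  by rewrite normr0 mulr0 ip_conj -[X in ip X](scale0r (0 : H)) ipZl mul0r conjC0 normr0.
have w2 : 0 < `|w| ^+ 2 by rewrite exprn_gt0// normr_gt0.
rewrite -(@ler_pXn2r _ 2)// ?nnegrE ?mulr_ge0// exprMn -ler_pdivrMr// -subr_ge0.
by rewrite -norm_sub_proj// exprn_ge0.
Qed.

Lemma ip_eq u w : w != 0 -> `|u| = `|w| -> `|ip u w| = `|w| ^+ 2 ->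
  exists a, u = a *: w.
Proof.
move=> w0 uw e; exists (ip u w / `|w| ^+ 2); apply/eqP; rewrite -subr_eq0 -normr_eq0.
have w2 : `|w| ^+ 2 != 0 by rewrite expf_neq0// normr_eq0.
rewrite -(@sqrf_eq0 R[i]) norm_sub_proj// e uw; move: w2.
by set x := `|w| ^+ 2 => x0; rewrite [x ^+ 2]expr2 mulfK// subrr.
Qed.

Lemma line_closed u w : w != 0 ->
  (forall e : R[i], 0 < e -> exists a, `|u - a *: w| <= e) -> exists a, u = a *: w.
Proof.
move=> w0 approx; pose b := ip u w / `|w| ^+ 2; exists b.
apply/eqP; rewrite -subr_eq0 -normr_le0; apply/ler_addgt0Pr => e e0; rewrite add0r.
have [|a ha] := approx e => //; apply: le_trans ha.
have w2 : 0 < `|w| ^+ 2 by rewrite exprn_gt0// normr_gt0.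
rewrite -(@ler_pXn2r _ 2)// ?nnegrE//.
have -> : u - b *: w = (u - a *: w) - (ip (u - a *: w) w / `|w| ^+ 2) *: w.
  rewrite ipBl ipZl -hilbert mulrBl mulfK ?gt_eqF// scalerBl opprB.
  by rewrite addrA subrK.
rewrite norm_sub_proj// gerBl.
by rewrite divr_ge0// ?exprn_ge0// ltW.
Qed.

End inner_product.

Section unitary.
Context {R : realType} {n : nat} {G : lieGroupType R n}.
Context {H : completeNormedModType R[i]}.
Variables (ip : {dot H for Num.conj}) (pi : G -> {linear H -> H}).
Hypothesis hilbert : hilbert_inner_product ip.
Hypothesis urep : unitary_representation ip pi.
Implicit Types (u v w : H).

Lemma rep_norm g u : `|pi g u| = `|u|.
Proof.
apply/eqP; rewrite -(@eqrXn2 _ 2)//; apply/eqP.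
by rewrite !hilbert (rep_isometry urep).
Qed.

Lemma rep_normB g u v : `|pi g u - pi g v| = `|u - v|.
Proof. by rewrite -linearB rep_norm. Qed.

Lemma repK g u : pi g^-1%g (pi g u) = u.
Proof. by rewrite -(repM urep) mulVg (rep1 urep). Qed.

Lemma rep_cvg (T : Type) (F : set_system T) {FF : Filter F} (f : T -> G) g u :
  f @ F --> g -> pi (f x) u @[x --> F] --> pi g u.
Proof.
move=> fg; apply: (@cvg_comp _ _ _ f (fun g => pi g u)); first exact: fg.
exact: (rep_strongly_continuous urep).
Qed.

Section eigenvector.
Variable w : H.
Hypothesis w0 : w != 0.

Definition line_stabilizer : set G := [set g | exists a, pi g w = a *: w].
Local Notation K := line_stabilizer.

Lemma line_stabilizer_norm g : K g -> exists2 a : R[i], `|a| = 1 & pi g w = a *: w.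
Proof.
move=> [a gw]; exists a => //; have := rep_norm g w; rewrite gw normrZ.
by rewrite -[RHS]mul1r => /mulIf; apply; rewrite normr_eq0.
Qed.

Lemma line_stabilizerM g h : K g -> K h -> K (g * h)%g.
Proof.
move=> [a ga] [b hb]; exists (b * a).
by rewrite (repM urep) hb linearZ ga /= scalerA.
Qed.

Lemma line_stabilizerV g : K g -> K (g^-1)%g.
Proof.
move=> /line_stabilizer_norm[a a1 ga]; exists a^-1.
have a0 : a != 0 by rewrite -normr_eq0 a1 oner_eq0.
by rewrite -[X in _ = _ *: X](repK g) ga [X in _ = _ *: X]linearZ scalerA mulVf// scale1r.
Qed.

(** The modulus of the matrix coefficient of w.  By the equality case of
Cauchy-Schwarz it takes its value at the identity only on K. *)
Definition transition (g : G) : R := complex.Re `|ip (pi g w) w|.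

Let transitionE g : (transition g)%:C%C = `|ip (pi g w) w|.
Proof. by rewrite /transition RRe_real// normr_real. Qed.

Lemma transition_left k g : K k -> transition (k * g)%g = transition g.
Proof.
move=> /line_stabilizer_norm[a a1 ka]; congr complex.Re.
have a0 : a != 0 by rewrite -normr_eq0 a1 oner_eq0.
have e : ip (pi (k * g)%g w) w = (a^-1)^* * ip (pi g w) w.
  rewrite -(rep_isometry urep k (pi g w) w) ka ipZr mulrA -rmorphM mulVf//.
  by rewrite rmorph1 mul1r (repM urep).
by rewrite e normrM norm_conjC normfV a1 invr1 mul1r.
Qed.

Lemma transition_right g k : K k -> transition (g * k)%g = transition g.
Proof.
move=> /line_stabilizer_norm[a a1 ka]; congr complex.Re.
by rewrite (repM urep) ka linearZ ipZl normrM a1 mul1r.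
Qed.

Lemma transition_eq1 g : transition g = transition 1%g -> K g.
Proof.
move=> e; apply: (ip_eq hilbert) => //; first exact: rep_norm.
by rewrite -transitionE e transitionE (rep1 urep) -hilbert normrX normr_id.
Qed.

Lemma transition_continuous : continuous transition.
Proof.
move=> g; apply/cvgrPdist_lt => e e0.
have nw : 0 < `|w| by rewrite normr_gt0.
have e'0 : 0 < e%:C%C / `|w| by rewrite divr_gt0// ltcR.
have cv : pi h w @[h --> g] --> pi g w by apply: rep_cvg; exact: cvg_id.
move/cvgrPdist_lt : cv => /(_ _ e'0).
apply: filterS => h; rewrite ltr_pdivlMr// => hlt.
rewrite -ltcR; apply: le_lt_trans hlt.
have -> : (`|transition g - transition h|)%:C%C =
    `| `|ip (pi g w) w| - `|ip (pi h w) w| |.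
  by rewrite -!transitionE -rmorphB /= normc_def /= expr0n addr0 sqrtr_sqr.
apply: (le_trans (ler_dist_dist _ _)).
by rewrite -(ipBl ip); exact: ip_le.
Qed.

(** With k^-1 g = x y, x in a compact set C and y in K, conjugating f by k and
applying the result to g w displaces it as much as f displaces x w. *)
Lemma conj_equicontinuous_vector g (e : R[i]) : connected [set: G] -> 0 < e ->
  \forall f \near (1%g : G), forall k, K k ->
    `|pi (k * f * k^-1)%g (pi g w) - pi g w| < e.
Proof.
move=> Gc e0.
have [C Cc Cg] := @orbits_relatively_compact R n G R transition K (@Rhausdorff R)
  transition_continuous line_stabilizerM
  transition_left transition_right transition_eq1 Gc g.
have : \forall f \near (1%g : G), C `<=` [set x | `|pi f (pi x w) - pi x w| < e].
  move/compact_near_coveringP : Cc; apply => x Cx.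
  have cv : pi p.2 (pi p.1 w) - pi p.1 w @[p --> ((x, 1%g) : G * G)] -->
      pi (1 * x)%g w - pi x w.
    apply: cvgB; last by apply: rep_cvg; exact: cvg_fst.
    under eq_fun do rewrite -(repM urep).
    by apply: rep_cvg; apply: cvg_mulg; [exact: cvg_snd|exact: cvg_fst].
  rewrite mul1g subrr in cv.
  by have /cvgrPdist_lt/(_ _ e0) := cv; apply: filterS => p; rewrite sub0r normrN.
apply: filterS => f fC k Kk.
have [x [y [Cx Ky xy]]] := Cg _ (line_stabilizerV Kk).
have [a a1 ya] := line_stabilizer_norm Ky.
have -> : pi (k * f * k^-1)%g (pi g w) - pi g w =
    pi k (pi f (pi (k^-1 * g)%g w) - pi (k^-1 * g)%g w).
  by rewrite linearB /= -!(repM urep) !mulgA mulgV mul1g.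
rewrite rep_norm xy (repM urep) ya linearZ /= linearZ /= -scalerBr normrZ a1 mul1r.
exact: fC.
Qed.

End eigenvector.

Section one_parameter.
Variable gamma : R -> G.
Hypothesis gammaD : forall s t, gamma (s + t) = (gamma s * gamma t)%g.

Variable w : H.
Hypothesis w0 : w != 0.

(** The first-order approximation (1 + s a) w is replaced by a vector of the same
norm as w, which costs no more than the error of the approximation since
gamma s acts isometrically. *)
Let small_step (a : R[i]) (e : R[i]) : 0 < e ->
  infinitesimal_generator (fun t => pi (gamma t)) w (a *: w) ->
  \forall s \near 0^', exists2 c : R[i], `|c| = 1 &
    `|pi (gamma s) w - c *: w| <= e * `|s|%:C%C.
Proof.
move=> e0 gen; have e20 : 0 < e / 2 by rewrite divr_gt0.
move/cvgrPdist_le : gen => /(_ _ e20); apply: filter_app; near=> s => hs.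
have s0 : s != 0 by near: s; exact: nbhs_dnbhs_neq.
have sC0 : s%:C%C != 0 by rewrite fmorph_eq0.
have ns : `|s%:C%C| = `|s|%:C%C by rewrite normc_def /= expr0n addr0 sqrtr_sqr.
pose b := 1 + s%:C%C * a.
have bw : `|pi (gamma s) w - b *: w| <= e / 2 * `|s|%:C%C.
  have -> : pi (gamma s) w - b *: w =
      - (s%:C%C *: (a *: w - s%:C%C^-1 *: (pi (gamma s) w - w))).
    rewrite scalerBr !scalerA mulfV// scale1r opprB /b scalerDl scale1r opprD.
    by rewrite addrA.
  by rewrite normrN normrZ ns mulrC ler_wpM2r// lecR.
have [b0|b0] := eqVneq b 0.
  exists 1; first exact: normr1.
  rewrite b0 scale0r subr0 rep_norm in bw.
  rewrite scale1r (le_trans (ler_normB _ _))// rep_norm.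
  by rewrite [leRHS](_ : _ = e / 2 * `|s|%:C%C + e / 2 * `|s|%:C%C) ?lerD// -mulrDl -splitr.
exists (b / `|b|); first by rewrite normrM normfV normr_id mulfV// normr_eq0.
have -> : pi (gamma s) w - (b / `|b|) *: w =
   (pi (gamma s) w - b *: w) + ((b - b / `|b|) *: w).
  by rewrite scalerBl addrA subrK.
rewrite (le_trans (ler_normD _ _))//.
have -> : e * `|s|%:C%C = e / 2 * `|s|%:C%C + e / 2 * `|s|%:C%C.
  by rewrite -mulrDl -splitr.
rewrite lerD//; apply: le_trans bw; rewrite distrC.
apply: le_trans (ler_dist_dist _ _); rewrite rep_norm !normrZ.
have -> : b - b / `|b| = (b / `|b|) * (`|b| - 1).
  by rewrite mulrBr mulr1 divfK// normr_eq0.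
rewrite normrM normrM normfV normr_id mulfV ?normr_eq0// mul1r.
by rewrite -[X in _ <= `|_ - X|]mul1r -mulrBl normrM normr_id.
Unshelve. all: by end_near. Qed.

(** The eigenvalue equation at time 0 implies that w moves in its line only.
Dividing the time t into k steps, the errors of the steps add up to o(1), since
gamma acts isometrically and the phases have modulus 1. *)
Lemma generator_eigenvector (a : R[i]) :
  infinitesimal_generator (fun t => pi (gamma t)) w (a *: w) ->
  forall t, line_stabilizer w (gamma t).
Proof.
move=> gen t; apply: (line_closed hilbert) => // e e0.
have [->|t0] := eqVneq t 0.
  by exists 1; rewrite one_param0// (rep1 urep) scale1r subrr normr0 ltW.
have nt0 : 0 < `|t|%:C%C :> R[i] by rewrite ltcR normr_gt0.
have e'0 : 0 < e / `|t|%:C%C by rewrite divr_gt0.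
have [r /= r0 hr] := small_step e'0 gen.
pose k := (Num.trunc (`|t| / r)).+1.
have kr : `|t| / r < k%:R by exact: truncnS_gt.
have k0 : 0 < k%:R :> R by rewrite ltr0n.
have := hr (t / k%:R); rewrite /= sub0r normrN normrM normfV (ger0_norm (ltW k0)).
rewrite ltr_pdivrMr// mulrC -ltr_pdivrMr// => /(_ kr).
rewrite mulf_neq0 ?invr_eq0 ?(gt_eqF k0)// => /(_ isT)[c c1 hc].
have step j : `|pi (gamma (t / k%:R *+ j)) w - c ^+ j *: w| <=
    j%:R * (e / `|t|%:C%C * (`|t| / k%:R)%:C%C).
  elim: j => [|j IH].
    by rewrite mulr0n one_param0// (rep1 urep) expr0 scale1r subrr normr0 mul0r.
  have -> : pi (gamma (t / k%:R *+ j.+1)) w - c ^+ j.+1 *: w =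
      c *: (pi (gamma (t / k%:R *+ j)) w - c ^+ j *: w) +
      pi (gamma (t / k%:R *+ j)) (pi (gamma (t / k%:R)) w - c *: w).
    rewrite mulrSr gammaD (repM urep) [pi _ (_ - _)]linearB /=.
    rewrite [pi _ (_ *: _)]linearZ /= scalerBr scalerA -exprS.
    by rewrite [RHS]addrC addrA subrK.
  rewrite (le_trans (ler_normD _ _))// normrZ c1 mul1r rep_norm.
  by rewrite -natr1 mulrDl mul1r lerD.
exists (c ^+ k); have := step k.
rewrite -mulr_natr divfK ?gt_eqF// => /le_trans; apply.
have -> : (`|t| / k%:R)%:C%C = `|t|%:C%C / k%:R :> R[i].
  by rewrite rmorphM /= fmorphV /= rmorph_nat.
have kC0 : k%:R != 0 :> R[i] by rewrite pnatr_eq0.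
by rewrite (mulrA (e / _)) divfK ?gt_eqF// mulrC divfK.
Qed.
End one_parameter.

Hypothesis irred : irreducible_representation pi.

(** The vectors all of whose translates are fixed by h form an invariant closed
subspace. *)
Lemma kernel_of_fixed_orbit w h : w != 0 ->
  (forall g, pi h (pi g w) = pi g w) -> representation_kernel pi h.
Proof.
move=> w0 hw; pose V := [set v : H | forall g, pi h (pi g v) = pi g v].
have hcl : closed_subspace V.
  split.
  - move=> v clv g; apply/eqP; rewrite -subr_eq0 -normr_le0.
    apply/ler_addgt0Pr => e e0; rewrite add0r.
    have e20 : 0 < e / 2 by rewrite divr_gt0.
    have [u [/= Vu]] := clv _ (nbhsx_ballx v _ e20).
    rewrite -ball_normE /= => /ltW uv.
    have -> : pi h (pi g v) - pi g v = (pi h (pi g v) - pi h (pi g u)) + (pi g u - pi g v).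
      by rewrite Vu addrA subrK.
    rewrite (le_trans (ler_normD _ _))// !rep_normB (distrC u) (splitr e).
    by rewrite lerD.
  - by move=> g; rewrite !linear0.
  - by move=> u v Vu Vv g; rewrite !linearD /= Vu Vv.
  - by move=> a u Vu g; rewrite !linearZ /= Vu.
have Vinv g u : V u -> V (pi g u) by move=> Vu k; rewrite -(repM urep k); exact: Vu.
have [_ /(_ V hcl Vinv)[V0|VT]] := irred.
  have : V w by []; rewrite V0 => /= w0'; move: w0; rewrite w0' eqxx//.
move=> u; have : V u by rewrite VT.
by move=> /(_ 1%g); rewrite !(rep1 urep).
Qed.


(** Elements of a small sphere around the identity are outside the kernel, so each
of them moves some translate of w; conjugates of f by gamma t hardly move it when
f is near the identity.  Hence t |-> gamma t f gamma (-t) stays inside the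
sphere. *)
Lemma conj_equicontinuous (gamma : R -> G) (w : H) (W : set G) :
  connected [set: G] -> discrete_subset (representation_kernel pi) ->
  w != 0 -> continuous gamma ->
  (forall s t, gamma (s + t) = (gamma s * gamma t)%g) ->
  (forall t, line_stabilizer w (gamma t)) -> nbhs (1%g : G) W ->
  \forall f \near (1%g : G), forall t, W (gamma t * f * gamma (- t))%g.
Proof.
move=> Gc disc w0 gc gD gK W1.
have [_ [V V1 VN]] : isolated (representation_kernel pi) 1%g.
  by apply: disc => u; rewrite (rep1 urep).
near (0 : R)^'+ => r.
have radm : forall x : 'rV[R]_n, `|x - origin G| <= r -> chart_cod (chart1 G) x.
  by near: r; exact: near0_cball_cod.
have rWV : coord_cball r `<=` W `&` V.
  by near: r; apply: nbhs_contains_cball; exact: filterI.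
have r0 : 0 < r by near: r; exact: nbhs_right_gt.
have avoid : \forall f \near (1%g : G),
    coord_sphere r `<=` [set h : G | forall t, (gamma t * f * gamma (- t))%g <> h].
  move/compact_near_coveringP : (compact_coord_sphere radm); apply => h [hd hr].
  have hN : ~ representation_kernel pi h.
    move=> Nh; have : (V `&` representation_kernel pi) h.
      by split=> //; apply: (rWV h _).2; split=> //; rewrite hr.
    rewrite VN => /= h1; move: hr; rewrite h1 subrr normr0 => r0'.
    by move: r0; rewrite -r0' ltxx.
  have [g hg] : exists g, pi h (pi g w) != pi g w.
    apply/not_existsP => hg; apply: hN; apply: (kernel_of_fixed_orbit w0) => g.
    by apply/eqP/negPn/negP; exact: hg.
  pose e := `|pi h (pi g w) - pi g w|.
  have e0 : 0 < e by rewrite normr_gt0 subr_eq0.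
  have cv : pi h' (pi g w) @[h' --> h] --> pi h (pi g w).
    by apply: rep_cvg; exact: cvg_id.
  have e20 : 0 < e / 2 by rewrite divr_gt0.
  move/cvgrPdist_lt : cv => /(_ _ e20) nearh.
  have nearf := conj_equicontinuous_vector w0 g Gc e20.
  exists ([set h' | `|pi h (pi g w) - pi h' (pi g w)| < e / 2],
      [set f | forall k, line_stabilizer w k ->
        `|pi (k * f * k^-1)%g (pi g w) - pi g w| < e / 2]); first by split.
  move=> [h' f] /= [hh' ff] t fh'; have := ff _ (gK t); rewrite -one_paramN// fh' => hh.
  have : e < e.
    rewrite {2}(splitr e); apply: le_lt_trans (ltrD hh' hh).
    by rewrite (le_trans _ (ler_normD _ _))// addrA subrK.
  by rewrite ltxx.
near=> f.
have fr : coord_ball r f by near: f; exact: nbhs_coord_ball.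
have avoidf : coord_sphere r `<=` [set h : G | forall t, (gamma t * f * gamma (- t))%g <> h].
  by near: f; exact: avoid.
pose cf t := (gamma t * f * gamma (- t))%g.
have cfc : continuous cf.
  move=> t; apply: cvg_mulg; first by apply: cvg_mulg; [exact: gc|exact: cvg_cst].
  apply: (@cvg_comp _ _ _ (fun t : R => - t) gamma (nbhs t) (nbhs (- t))); last exact: gc.
  by apply: cvgN; exact: cvg_id.
have : cf @^-1` coord_ball r = [set: R].
  have : connected [set: R] by apply/connected_intervalP => x y _ _ z _.
  apply.
  - by exists 0; rewrite /= /cf oppr0 one_param0// mul1g mulg1.
  - exists (cf @^-1` coord_ball r); last by rewrite setTI.
    by apply: open_comp => [x _|]; [exact: cfc|exact: open_coord_ball].
  - exists (cf @^-1` coord_cball r).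
      by move/continuous_closedP : cfc; apply; exact: closed_coord_cball.
    rewrite setTI; apply/seteqP; split=> t /= [td tr]; split=> //; first exact: ltW.
    rewrite lt_neqAle tr andbT; apply/eqP => tr'.
    by apply: (avoidf (cf t) _ t).
move=> /seteqP[_ all] t; have [td /ltW tr] := all t I.
by have [] := rWV (cf t) (conj td tr).
Unshelve. all: by end_near. Qed.

End unitary.

(** * Elliptic elements *)

Theorem corollary6p5 (R : realType) (n : nat) (G : lieGroupType R n)
    (H : completeNormedModType R[i]) (ip : {dot H for Num.conj})
    (pi : G -> {linear H -> H}) (d : 'rV[R]_n) :
  connected [set: G] ->
  hilbert_inner_product ip ->
  unitary_representation ip pi ->
  irreducible_representation pi ->
  discrete_subset (representation_kernel pi) ->
  has_eigenvector (derived_operator pi d) ->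
  elliptic (ad G d).
Proof.
move=> Gc hilb urep irred disc [w [a [w0 [gamma [gc gD gd] gen]]]].
have gK := generator_eigenvector hilb urep gD w0 gen.
have equi W := @conj_equicontinuous _ _ _ _ _ _ hilb urep irred gamma w W Gc disc w0 gc gD gK.
have cjM t g h : (gamma t * (g * h) * gamma (- t) =
    gamma t * g * gamma (- t) * (gamma t * h * gamma (- t)))%g.
  by rewrite (one_paramN gD) !mulgA mulgVK.
have [C lip] := equicontinuous_lipschitz cjM equi.
exact: elliptic_of_lipschitz gc gD gd lip.
Qed.
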